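(* Let $n,r,m,p,N$ be positive integers with $r\le n$. Consider the data, the ambient manifold $\overline{\mathcal M}$ with its Riemannian metric, the reduced-order model and its parameterization, and the constrained optimization problem described in the context. Write this problem as an equivalent unconstrained problem with ambient-space Lagrangian $$ \overline L(\Phi,\overline\Psi,K,R,Q,S,B)=\sum_{i=0}^{N-1}\Bigl\{\overline J_i+\int_{t_0}^{t_i}\lambda_i^\top\Bigl(\frac{\mathrm d z}{\mathrm d t}-\widetilde f_r(z,u)\Bigr)\,\mathrm dt+\lambda_i(t_0)^\top\bigl(z(t_0)-\overline\Psi^\top x(t_0)\bigr)\Bigr\}, $$ where $\overline J_i=\lVert e(t_i)\rVert^2$ with $e(t_i):=y(t_i)-h\bigl(\Phi(\overline\Psi^\top\Phi)^{-1}z(t_i)\bigr)$, $z(t)\in\mathbb R^r$ is the reduced-order trajectory satisfying $\mathrm dz/\mathrm dt=\widetilde f_r(z,u)$, $z(t_0)=\overline\Psi^\top x(t_0)$, and $\lambda_i(t)\in\mathbb R^r$, $t\in[t_0,t_i]$, is the $i$-th Lagrange multiplier. Let $C$ be the Jacobian of $h$, $C_{j,k}:=\partial h_j/\partial x_k$, with $C(t_i)$ denoting its value at $\Phi(\overline\Psi^\top\Phi)^{-1}z(t_i)$. Let $\lambda_i$ satisfy the reduced-order adjoint equation $$ -\frac{\mathrm d\lambda_i}{\mathrm dt}=\bigl[\partial_z\widetilde f_r(z)\bigr]^\top\lambda_i,\qquad \lambda_i(t_i)=2(\Phi^\top\overline\Psi)^{-1}\Phi^\top C(t_i)^\top e(t_i),\qquad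 t\in[t_0,t_i]. $$ Then the gradient of $\overline L$, with respect to the metric on $\overline{\mathcal M}$, is given component-wise by $$ \begin{aligned} \nabla_{\Phi}\overline L&=\Bigl\{-2\sum_{i=0}^{N-1}\bigl(I-\overline\Psi(\Phi^\top\overline\Psi)^{-1}\Phi^\top\bigr)C(t_i)^\top e(t_i)z(t_i)^\top(\Phi^\top\overline\Psi)^{-1}\Bigr\}(\Phi^\top\Phi),\\ \nabla_{\overline\Psi}\overline L&=\sum_{i=0}^{N-1}\Bigl(2\Phi(\overline\Psi^\top\Phi)^{-1}z(t_i)e(t_i)^\top C(t_i)\Phi(\overline\Psi^\top\Phi)^{-1}-x(t_0)\lambda_i(t_0)^\top\Bigr),\\ \nabla_K\overline L&=(\nabla_A\overline L)Q^{-1}Q^{-\top}-Q^{-1}Q^{-\top}(\nabla_A\overline L)^\top,\\ \nabla_R\overline L&=-\Bigl((\nabla_A\overline L)Q^{-1}Q^{-\top}+Q^{-1}Q^{-\top}(\nabla_A\overline L)^\top\Bigr)R,\\ \nabla_Q\overline L&=-Q^{-\top}\Bigl(\nabla_{\widetilde Q}\overline L+(\nabla_{\widetilde Q}\overline L)^\top\Bigr)Q^{-1}Q^{-\top},\\ \nabla_{\widetilde Q}\overline L&=\bigl(K-K^\top-RR^\top\bigr)^\top\nabla_A\overline L+\sum_{k=1}^r\bigl((S)_k^\top-(S)_k\bigr)(\nabla_H\overline L)_k,\\ \nabla_{(S)_k}\overline L&=(\nabla_{(H)_k}\overline L)Q^{-1}Q^{-\top}-Q^{-1}Q^{-\top}(\nabla_{(H)_k}\overline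 L)^\top,\qquad k\in\{1,\dots,r\},\\ \nabla_B\overline L&=-\sum_{i=0}^{N-1}\int_{t_0}^{t_i}\lambda_i u^\top\,\mathrm dt, \end{aligned} $$ where $$ \nabla_A\overline L=-\sum_{i=0}^{N-1}\int_{t_0}^{t_i}\lambda_i z^\top\,\mathrm dt,\qquad \nabla_H\overline L=-\sum_{i=0}^{N-1}\int_{t_0}^{t_i}\lambda_i\otimes z\otimes z\,\mathrm dt . $$
   Context: **Data (fixed).** Sample times $t_0\le t_1\le\dots\le t_{N-1}$; an integrable input $u:[t_0,t_{N-1}]\to\mathbb R^m$; an initial full-order state $x(t_0)\in\mathbb R^n$; measured outputs $y(t_i)\in\mathbb R^p$; a differentiable output map $h:\mathbb R^n\to\mathbb R^p$. $\lVert\cdot\rVert$ is the Euclidean norm and $I$ the identity matrix. **Ambient manifold.** $$\overline{\mathcal M}=\mathbb R_*^{n\times r}\times\mathbb R^{n\times r}\times\mathbb R^{r\times r}\times\mathbb R^{r\times r}\times\mathbb R^{r\times r}\times\mathbb R^{r\times r\times r}\times\mathbb R^{r\times m},$$ with points $(\Phi,\overline\Psi,K,R,Q,S,B)$, where $\mathbb R_*^{n\times r}$ is the set of $n\times r$ matrices of full column rank. We work at points where $\overline\Psi^\top\Phi$ and $Q$ are invertible (an open set). The metric is the product metric in which the $\Phi$-factor carries $g_\Phi(\xi,\eta)=\mathrm{Tr}\bigl((\Phi^\top\Phi)^{-1}\xi^\top\eta\bigr)$, the $\overline\Psi$-factor carries $\mathrm{Tr}(\xi^\top\eta)$, and all remaining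 factors carry the usual Euclidean (entrywise) inner product. The gradient component in each factor is the Riesz representative, with respect to that factor's inner product, of the corresponding partial differential. **Tensor notation.** For $T\in\mathbb R^{r\times r\times r}$, the $k$-th frontal slice is $(T)_k:=T_{:,:,k}$. The contraction is $(H:zz^\top)_i=\sum_{p,q=1}^r H_{ipq}z_pz_q$, and $(a\otimes b\otimes c)_{ijk}=a_ib_jc_k$. Also $\nabla_{(H)_k}\overline L=(\nabla_H\overline L)_k$, and $\nabla_{(S)_k}\overline L$ is the $k$-th frontal slice of $\nabla_S\overline L$. $Q^{-\top}=(Q^{-1})^\top$. **Parameterized reduced-order dynamics.** $$\widetilde f_r(z,u)=Az+H:zz^\top+Bu,\qquad A=(K-K^\top-RR^\top)\widetilde Q,\qquad (H)_k=\bigl((S)_k-(S)_k^\top\bigr)\widetilde Q\ \ (k=1,\dots,r),\qquad \widetilde Q=Q^{-1}Q^{-\top}.$$ $\partial_z\widetilde f_r(z)$ is the Jacobian matrix of $\widetilde f_r$ in $z$. **Auxiliary gradients.** $\nabla_A\overline L$ and $\nabla_H\overline L$ are the Euclidean gradients with respect to $A$ and $H$ viewed as independent variables. $\nabla_{\widetilde Q}\overline L$ is the Euclidean gradient with respect to $\widetilde Q$, viewed as a free $r\times r$ matrix variable entering $A$ and $H$ through the formulas $A=(K-K^\top-RR^\top)\widetilde Q$ and $(H)_k=\bigl((S)_k-(S)_k^\top\bigr)\widetilde Q$ $(k=1,\dots,r)$, with all other parameters fixed. **Constrained optimization problem.** Let $\mathcal M$ be the product of the Grassmann manifold of $r$-dimensional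 subspaces of $\mathbb R^n$, the Stiefel manifold of $n\times r$ matrices with orthonormal columns, and the linear spaces $\mathbb R^{r\times r}$ (three times), $\mathbb R^{r\times r\times r}$, $\mathbb R^{r\times m}$. Minimize over $(V,\Psi,K,R,Q,S,B)\in\mathcal M$ the cost $J=\sum_{i=0}^{N-1}\lVert y(t_i)-\hat y(t_i)\rVert^2$ subject to $\mathrm dz/\mathrm dt=\widetilde f_r(z,u)$, $z(t_0)=\Psi^\top x(t_0)$, $\hat y=h\bigl(\Phi(\Psi^\top\Phi)^{-1}z\bigr)$, $V=\mathrm{Range}(\Phi)$, with $A$ and $H$ parameterized by $A=(K-K^\top-RR^\top)Q^{-1}Q^{-\top}$ and $(H)_k=\bigl((S)_k-(S)_k^\top\bigr)Q^{-1}Q^{-\top}$ for $k=1,\dots,r$. The ambient-space version replaces $V$ by $\Phi\in\mathbb R_*^{n\times r}$ and $\Psi$ by an arbitrary $\overline\Psi\in\mathbb R^{n\times r}$. *)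

(* Defs.v *)
From HB Require Import structures.
From mathcomp Require Import all_boot all_order all_algebra.
From mathcomp Require Import all_classical all_reals all_analysis.

Set Implicit Arguments.
Unset Strict Implicit.
Unset Printing Implicit Defensive.

Import Order.TTheory GRing.Theory Num.Theory.
Import numFieldNormedType.Exports.

Local Open Scope classical_set_scope.
Local Open Scope ring_scope.

(* The library norm `|.| on matrices is the max norm; [enorm] is the Euclidean
   one. *)
Definition inner (R : realType) (m n : nat) (X Y : 'M[R]_(m, n)) : R :=
  \sum_(i < m) \sum_(j < n) X i j * Y i j.

Definition enorm (R : realType) (n : nat) (v : 'cV[R]_n) : R :=
  Num.sqrt (inner v v).

Definition mx_integral (R : realType) (m n : nat) (a b : R)
    (M : R -> 'M[R]_(m, n)) : 'M[R]_(m, n) :=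
  \matrix_(i, j) \int[@lebesgue_measure R]_(s in `[a, b]) (M s i j).

(* Column-vector convention, (j, k) entry = d f_j / d x_k; the library's
   [jacobian] acts on row vectors and is the transpose of this. *)
Definition Jac (R : realType) (n p : nat) (f : 'cV[R]_n -> 'cV[R]_p)
    (x : 'cV[R]_n) : 'M[R]_(p, n) :=
  \matrix_(j, k) 'D_(delta_mx k 0) (fun x' : 'cV[R]_n => f x' j 0) x.

(* A tensor in R^(r x r x r) is stored through its mode-3 unfolding, so that it
   inherits the normed module structure of matrices: row k is the vectorized
   frontal slice T_(:,:,k). *)
Definition tensor (R : realType) (r : nat) := 'M[R]_(r, r * r).

Definition slice (R : realType) (r : nat) (T : tensor R r) (k : 'I_r)
  : 'M[R]_r := vec_mx (row k T).

Definition of_slices (R : realType) (r : nat) (M : 'I_r -> 'M[R]_r)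
  : tensor R r := \matrix_(k < r) mxvec (M k).

Definition tentry (R : realType) (r : nat) (T : tensor R r) (i j k : 'I_r) : R :=
  slice T k i j.

Definition outer (R : realType) (r : nat) (a b c : 'cV[R]_r) : tensor R r :=
  of_slices (fun k => \matrix_(i, j) (a i 0 * b j 0 * c k 0)).

(* H : z z^T *)
Definition contract (R : realType) (r : nat) (H : tensor R r) (z : 'cV[R]_r)
  : 'cV[R]_r :=
  \col_i \sum_(p < r) \sum_(q < r) tentry H i p q * z p 0 * z q 0.

(* Only the entries of index < nsamp of the sequences [time] and [output]
   matter, and [input] only on [time 0, time nsamp.-1]. *)
Record rom_data (R : realType) (n m p : nat) := RomData {
  nsamp  : nat;
  time   : nat -> R;
  input  : R -> 'cV[R]_m;
  state0 : 'cV[R]_n;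
  output : nat -> 'cV[R]_p;
  outmap : 'cV[R]_n -> 'cV[R]_p }.

Definition tstart (R : realType) (n m p : nat) (D : rom_data R n m p) : R :=
  time D 0.

Definition tend (R : realType) (n m p : nat) (D : rom_data R n m p) : R :=
  time D (nsamp D).-1.

Definition rom_data_ok (R : realType) (n m p : nat) (D : rom_data R n m p)
  : Prop :=
  [/\ (0 < nsamp D)%N,
      forall i, (i.+1 < nsamp D)%N -> time D i <= time D i.+1,
      forall j : 'I_m, (@lebesgue_measure R).-integrable `[tstart D, tend D]
        (fun s => (input D s j 0)%:E)
    & forall x, differentiable (outmap D) x].

Definition red_field (R : realType) (r m : nat) (A : 'M[R]_r) (H : tensor R r)
    (B : 'M[R]_(r, m)) (z : 'cV[R]_r) (u : 'cV[R]_m) : 'cV[R]_r :=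
  A *m z + contract H z + B *m u.

(* The input is merely integrable, so dz/dt = f(z, u) is understood in the sense
   of Caratheodory: z is continuous and satisfies the integrated equation. *)
Definition is_trajectory (R : realType) (n m p r : nat) (D : rom_data R n m p)
    (Psi : 'M[R]_(n, r)) (A : 'M[R]_r) (H : tensor R r) (B : 'M[R]_(r, m))
    (z : R -> 'cV[R]_r) : Prop :=
  [/\ {within `[tstart D, tend D], continuous z},
      z (tstart D) = Psi^T *m state0 D
    & forall s, s \in `[tstart D, tend D] ->
        z s = z (tstart D) + mx_integral (tstart D) s
                (fun s' => red_field A H B (z s') (input D s'))].

(* A trajectory is unique on [tstart, tend] but can blow up before [tend]; the
   value of [trajectory] is junk at parameters for which none exists.  Existence
   on all of [tstart, tend] is an open condition on the parameters, so the junk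
   does not affect differentials at a point where a trajectory exists. *)
Definition trajectory (R : realType) (n m p r : nat) (D : rom_data R n m p)
    (Psi : 'M[R]_(n, r)) (A : 'M[R]_r) (H : tensor R r) (B : 'M[R]_(r, m))
  : R -> 'cV[R]_r :=
  xget (fun=> 0) [set z | is_trajectory D Psi A H B z].

Definition lift_state (R : realType) (n r : nat) (Phi Psi : 'M[R]_(n, r))
    (z : 'cV[R]_r) : 'cV[R]_n := Phi *m invmx (Psi^T *m Phi) *m z.

Definition out_err (R : realType) (n m p r : nat) (D : rom_data R n m p)
    (Phi Psi : 'M[R]_(n, r)) (z : R -> 'cV[R]_r) (i : nat) : 'cV[R]_p :=
  output D i - outmap D (lift_state Phi Psi (z (time D i))).

Definition out_jac (R : realType) (n m p r : nat) (D : rom_data R n m p)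
    (Phi Psi : 'M[R]_(n, r)) (z : R -> 'cV[R]_r) (i : nat) : 'M[R]_(p, n) :=
  Jac (outmap D) (lift_state Phi Psi (z (time D i))).

Definition is_adjoint (R : realType) (n m p r : nat) (D : rom_data R n m p)
    (Phi Psi : 'M[R]_(n, r)) (A : 'M[R]_r) (H : tensor R r) (B : 'M[R]_(r, m))
    (z : R -> 'cV[R]_r) (i : nat) (lam : R -> 'cV[R]_r) : Prop :=
  [/\ {within `[tstart D, time D i], continuous lam},
      forall s, s \in `]tstart D, time D i[ ->
        derivable lam s 1 /\
        - derive1 lam s
          = (Jac (fun z' => red_field A H B z' (input D s)) (z s))^T *m lam s
    & lam (time D i) = 2 *: (invmx (Phi^T *m Psi) *m Phi^T
        *m (out_jac D Phi Psi z i)^T *m out_err D Phi Psi z i)].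

(* The ambient-space Lagrangian as a function of A and H viewed as independent
   variables.  z follows the parameters, so the multiplier terms vanish whenever
   z exists and the value does not depend on the functions lam_i; these are held
   fixed. *)
Definition lagrangian_AH (R : realType) (n m p r : nat) (D : rom_data R n m p)
    (lam : nat -> R -> 'cV[R]_r) (Phi Psi : 'M[R]_(n, r)) (A : 'M[R]_r)
    (H : tensor R r) (B : 'M[R]_(r, m)) : R :=
  let z := trajectory D Psi A H B in
  \sum_(i < nsamp D)
    (enorm (out_err D Phi Psi z i) ^+ 2
     + \int[@lebesgue_measure R]_(s in `[tstart D, time D i])
         inner (lam i s) (derive1 z s - red_field A H B (z s) (input D s))
     + inner (lam i (tstart D)) (z (tstart D) - Psi^T *m state0 D)).

Definition A_of (R : realType) (r : nat) (K Rd Qt : 'M[R]_r) : 'M[R]_r :=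
  (K - K^T - Rd *m Rd^T) *m Qt.

Definition H_of (R : realType) (r : nat) (S : tensor R r) (Qt : 'M[R]_r)
  : tensor R r :=
  of_slices (fun k => (slice S k - (slice S k)^T) *m Qt).

Definition Qtilde (R : realType) (r : nat) (Q : 'M[R]_r) : 'M[R]_r :=
  invmx Q *m (invmx Q)^T.

Definition lagrangian_Qt (R : realType) (n m p r : nat) (D : rom_data R n m p)
    (lam : nat -> R -> 'cV[R]_r) (Phi Psi : 'M[R]_(n, r)) (K Rd Qt : 'M[R]_r)
    (S : tensor R r) (B : 'M[R]_(r, m)) : R :=
  lagrangian_AH D lam Phi Psi (A_of K Rd Qt) (H_of S Qt) B.

(* Points (Phi, Psi, K, R, Q, S, B); the open conditions (full column rank of
   Phi, invertibility of Psi^T Phi and Q) are imposed on the base point. *)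
Definition ambient (R : realType) (n m r : nat) : Type :=
  ('M[R]_(n, r) * 'M[R]_(n, r) * 'M[R]_r * 'M[R]_r * 'M[R]_r * tensor R r
   * 'M[R]_(r, m))%type.

Definition lagrangian (R : realType) (n m p r : nat) (D : rom_data R n m p)
    (lam : nat -> R -> 'cV[R]_r) (x : ambient R n m r) : R :=
  let: (Phi, Psi, K, Rd, Q, St, B) := x in
  lagrangian_Qt D lam Phi Psi K Rd (Qtilde Q) St B.

Definition metric (R : realType) (n m r : nat) (x xi eta : ambient R n m r) : R :=
  let: (Phi, _, _, _, _, _, _) := x in
  let: (xPhi, xPsi, xK, xR, xQ, xS, xB) := xi in
  let: (ePhi, ePsi, eK, eR, eQ, eS, eB) := eta in
  \tr (invmx (Phi^T *m Phi) *m xPhi^T *m ePhi) + \tr (xPsi^T *m ePsi)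
  + inner xK eK + inner xR eR + inner xQ eQ + inner xS eS + inner xB eB.

(* [G] is the Riesz representative, for the inner product [g], of the
   differential of [f] at [x]. *)
Definition is_gradient (R : realType) (V : normedModType R) (g : V -> V -> R)
    (f : V -> R) (x G : V) : Prop :=
  differentiable f x /\ forall v, 'd f x v = g G v.

(* Main.v *)
From HB Require Import structures.
Require Import Defs.
From mathcomp Require Import all_boot all_order all_algebra.
From mathcomp Require Import all_classical all_reals all_analysis.
From mathcomp Require Import measurable_realfun ring lra.
Set Implicit Arguments.
Unset Strict Implicit.
Unset Printing Implicit Defensive.
Import Order.TTheory GRing.Theory Num.Theory.
Import numFieldNormedType.Exports.
Local Open Scope classical_set_scope.
Local Open Scope ring_scope.

(** Along a trajectory the multiplier terms vanish, so near the base point the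
    Lagrangian is the sum of the squared output errors and the multipliers only
    serve to differentiate it.

    Let [w] be the difference between the trajectory for perturbed parameters
    and the one for the base parameters.  Subtracting the two equations, the
    non-smooth input drops out of the terms depending on [w], so [w] solves an
    integral equation with a continuous, locally Lipschitz right-hand side:
    Picard iteration gives existence on the whole time interval, and Gronwall's
    inequality gives uniqueness and [|w| <= C d], with [d] the size of the
    perturbation.  The first variation of the state is not needed.  Pairing [w]
    with the adjoint state and integrating by parts cancels the part of the
    right-hand side that is linear in [w] and leaves
      [lam(t_i)^T w(t_i) = lam(t_0)^T dPsi^T x_0
         + int lam^T (dA z + dH : z z^T + dB u) + O(d^2)].
    Since [- lam(t_i)] is the gradient of the [i]-th squared error with respect
    to [z(t_i)], this yields the differential of the Lagrangian with respect to
    [(Phi, Psi, A, H, B)]; the chain rule through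
    [(K, R, Q, S) |-> (A, H)] gives the remaining components. *)

(** * Integrals over segments *)

(** Since the input is only integrable, a trajectory is a primitive and has a derivative only almost
    everywhere. This matters in two places: the multiplier integral contains [derive1 z], and the
    product of adjoint and state cannot be differentiated at every time. Integration by parts still
    works because the adjoint is smooth enough: the input enters the field additively, so the
    Jacobian in the state does not see it and is continuous in time. A Lipschitz bound on [w] can
    replace the derivative of the flow because the field is quadratic. Once the adjoint has
    cancelled the part linear in [w], every remaining term that contains [w] has two factors of size
    [d]. The hypotheses live on closed segments. Composing with the projection [clamp] extends paths
    continuously to the whole line, which confines the subspace topology to a few conversions.
    Differentiability is obtained from explicit epsilon-delta bounds in the max norm; this is the
    origin of the dimension factors in the constants. *)

Section RealContinuity.
Context {R : realType}.
Implicit Types f g : R -> R.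

Lemma continuous_fcst (k : R) : continuous (fun _ : R => k).
Proof. by move=> x; exact: cvg_cst. Qed.

Lemma continuous_fD f g : continuous f -> continuous g ->
  continuous (fun x => f x + g x).
Proof. by move=> cf cg x; apply: cvgD; [exact: cf|exact: cg]. Qed.

Lemma continuous_fB f g : continuous f -> continuous g ->
  continuous (fun x => f x - g x).
Proof. by move=> cf cg x; apply: cvgB; [exact: cf|exact: cg]. Qed.

Lemma continuous_fM f g : continuous f -> continuous g ->
  continuous (fun x => f x * g x).
Proof. by move=> cf cg x; apply: cvgM; [exact: cf|exact: cg]. Qed.

Lemma continuous_fsum (I : Type) (r : seq I) (P : pred I) (F : I -> R -> R) :
  (forall i, P i -> continuous (F i)) ->
  continuous (fun s => \sum_(i <- r | P i) F i s).
Proof.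
move=> cF; elim: r => [|i r IH].
  by under eq_fun do rewrite big_nil; exact: continuous_fcst.
under eq_fun do rewrite big_cons; case: (boolP (P i)) => // Pi.
by apply: continuous_fD => //; exact: cF.
Qed.

End RealContinuity.
Arguments continuous_fcst {R} k x.
Arguments continuous_fD {R} f g cf cg x : rename.
Arguments continuous_fB {R} f g cf cg x : rename.
Arguments continuous_fM {R} f g cf cg x : rename.
Arguments continuous_fsum {R I} r P F cF x : rename.

Section SegmentIntegral.
Context {R : realType}.
Notation mu := (@lebesgue_measure R).
Implicit Types (a b c : R) (f g : R -> R).

Definition sintegrable a b f := mu.-integrable `[a, b] (EFin \o f).
(** Unoriented: for [b < a] the segment is empty and the value is 0, hence the order hypotheses in
    the lemmas below. *)
Definition sint a b f : R := \int[mu]_(s in `[a, b]) f s.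

Lemma sint_eq a b f g : (forall s, a <= s <= b -> f s = g s) ->
  sint a b f = sint a b g.
Proof.
move=> fg; apply: eq_Rintegral => s; rewrite inE/= in_itv/=; exact: fg.
Qed.

Lemma sintegrable_eq a b f g : (forall s, a <= s <= b -> f s = g s) ->
  sintegrable a b f -> sintegrable a b g.
Proof.
move=> fg; apply: eq_integrable => // s; rewrite inE/= in_itv/= => /fg.
by rewrite /= => ->.
Qed.

Lemma sintegrableS a b c d f : a <= c -> d <= b ->
  sintegrable a b f -> sintegrable c d f.
Proof.
move=> ac db; apply: integrableS => //.
by apply: subset_itvScc; rewrite bnd_simp.
Qed.

Lemma continuous_sintegrable a b f : continuous f -> sintegrable a b f.
Proof.
move=> cf; apply: continuous_compact_integrable; first exact: segment_compact.
exact: continuous_subspaceT.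
Qed.

Lemma sint_pt a f : sint a a f = 0.
Proof. by rewrite /sint set_itv1 Rintegral_set1. Qed.

Lemma sint_cat a b c f : a <= c <= b -> sintegrable a b f ->
  sint a b f = sint a c f + sint c b f.
Proof.
move=> /andP[ac cb] fi.
apply/eqP; rewrite addrC -subr_eq; apply/eqP.
rewrite /sint (Rintegral_itvB fi) ?bnd_simp//.
(* The difference of the two integrals lives on a half-open interval; adding the null point [c]
   closes it. *)
rewrite Rintegral_itv_obnd_cbnd//.
apply: integrableS fi => //.
by apply: subset_itv; rewrite bnd_simp.
Qed.

Lemma sintegrableD a b f g : sintegrable a b f -> sintegrable a b g ->
  sintegrable a b (fun s => f s + g s).
Proof.
move=> fi gi; have := integrableD _ fi gi; apply => //.
Qed.

Lemma sintegrableZ a b k f : sintegrable a b f ->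
  sintegrable a b (fun s => k * f s).
Proof.
move=> fi; have := integrableZl _ k fi; apply => //.
Qed.

Lemma sintegrableN a b f : sintegrable a b f ->
  sintegrable a b (fun s => - f s).
Proof.
move=> /(sintegrableZ (-1)); apply: sintegrable_eq => s _; by rewrite mulN1r.
Qed.

Lemma sintegrableB a b f g : sintegrable a b f -> sintegrable a b g ->
  sintegrable a b (fun s => f s - g s).
Proof. by move=> fi gi; apply: sintegrableD => //; apply: sintegrableN. Qed.

Lemma sintegrable_abs a b f : sintegrable a b f ->
  sintegrable a b (fun s => `|f s|).
Proof. move=> fi; have := integrable_abse fi; exact. Qed.

Lemma sintegrable_sum a b (I : Type) (r : seq I) (P : pred I) (F : I -> R -> R) :
  (forall i, P i -> sintegrable a b (F i)) ->
  sintegrable a b (fun s => \sum_(i <- r | P i) F i s).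
Proof.
move=> Fi; elim: r => [|i r IH].
  apply: continuous_sintegrable; under eq_fun do rewrite big_nil.
  exact: continuous_fcst.
apply: (@sintegrable_eq _ _
  (fun s => (if P i then F i s else 0) + \sum_(j <- r | P j) F j s)).
  by move=> s _; rewrite big_cons; case: (P i); rewrite ?add0r.
apply: sintegrableD => //; case: (boolP (P i)) => Pi; first exact: Fi.
by apply: continuous_sintegrable; exact: continuous_fcst.
Qed.

Lemma sintegrableM a b f g : continuous f -> sintegrable a b g ->
  sintegrable a b (fun s => f s * g s).
Proof.
move=> cf gi; have mab : measurable `[a, b] by [].
have := @integrableMr _ _ _ mu `[a, b] mab f (EFin \o g).
apply => //.
- apply: measurable_funTS; by apply: continuous_measurable_fun.
(* The bound on [f] comes from the extreme value theorem, which needs a nonempty segment; on an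
   empty one any bound works. *)
- have [ab|ab] := leP a b; last first.
    rewrite set_itv_ge ?bnd_simp -?ltNge//.
    by exists 0; split => // ? ?; move=> x.
  have cf' : {within `[a, b], continuous (fun s => `|f s|)}.
    apply: continuous_subspaceT => x.
    by apply: continuous_comp; [exact: cf|exact: norm_continuous].
  have [c _ cM] := EVT_max ab cf'.
  exists `|f c|; split; first by rewrite realE normr_ge0.
  move=> M cM' s /= sab; apply: le_trans (ltW cM'); exact: cM.
Qed.

Lemma sintD a b f g : sintegrable a b f -> sintegrable a b g ->
  sint a b (fun s => f s + g s) = sint a b f + sint a b g.
Proof. by move=> fi gi; rewrite /sint RintegralD. Qed.

Lemma sintB a b f g : sintegrable a b f -> sintegrable a b g ->
  sint a b (fun s => f s - g s) = sint a b f - sint a b g.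
Proof. by move=> fi gi; rewrite /sint RintegralB. Qed.

Lemma sintZ a b k f : sintegrable a b f ->
  sint a b (fun s => k * f s) = k * sint a b f.
Proof. by move=> fi; rewrite /sint RintegralZl. Qed.

Lemma sint0 a b : sint a b (fun=> 0) = 0 :> R.
Proof. by rewrite /sint /Rintegral integral0. Qed.

Lemma sint_cst a b k : a <= b -> sint a b (fun=> k) = k * (b - a).
Proof.
move=> ab; rewrite /sint Rintegral_cst//= lebesgue_measure_itv/= lte_fin.
by case: ltgtP ab => // ->; rewrite subrr.
Qed.

Lemma sint_sum a b (I : Type) (r : seq I) (P : pred I) (F : I -> R -> R) :
  (forall i, P i -> sintegrable a b (F i)) ->
  sint a b (fun s => \sum_(i <- r | P i) F i s)
  = \sum_(i <- r | P i) sint a b (F i).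
Proof.
move=> Fi; elim: r => [|i r IH].
  rewrite big_nil -[RHS](sint0 a b).
  by apply: sint_eq => s _; rewrite big_nil.
rewrite big_cons -IH.
case: (boolP (P i)) => Pi.
  rewrite -sintD; [|exact: Fi|exact: sintegrable_sum].
  by apply: sint_eq => s _; rewrite big_cons Pi.
by apply: sint_eq => s _; rewrite big_cons (negPf Pi).
Qed.

Lemma sint_le a b f g : sintegrable a b f -> sintegrable a b g ->
  (forall s, a <= s <= b -> f s <= g s) -> sint a b f <= sint a b g.
Proof.
move=> fi gi fg; apply: le_Rintegral => // s; rewrite /= in_itv/=; exact: fg.
Qed.

Lemma sint_ge0 a b f : (forall s, a <= s <= b -> 0 <= f s) -> 0 <= sint a b f.
Proof.
by move=> f0; apply: Rintegral_ge0 => s; rewrite /= in_itv/=; exact: f0.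
Qed.

Lemma sint_abs_le a b f g : sintegrable a b f -> sintegrable a b g ->
  (forall s, a <= s <= b -> `|f s| <= g s) -> `|sint a b f| <= sint a b g.
Proof.
move=> fi gi fg; apply: le_trans (le_normr_Rintegral _ fi) _ => //.
by apply: sint_le => //; exact: sintegrable_abs.
Qed.

(* A partition into [k] equal pieces bounds [|E b - E a|] by
   [C (b - a) (P b - P a) / k]. *)
Lemma eq_of_product_modulus (E P : R -> R) a b (C : R) : a <= b ->
  (forall s t, a <= s -> s <= t -> t <= b ->
     `|E t - E s| <= C * (t - s) * (P t - P s)) ->
  E a = E b.
Proof.
move=> ab H.
suff Hn k : `|E b - E a| <= C * (b - a) * (P b - P a) / k.+1%:R.
  apply/esym/eqP; rewrite -subr_eq0 -normr_le0 leNgt; apply/negP => E0.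
  set c := C * (b - a) * (P b - P a) in Hn.
  have c0 : 0 <= c by have := Hn 0%N; rewrite divr1 => /(le_trans _); apply.
  set D := `|E b - E a| in E0 Hn *.
  pose K := Num.bound (c / D).
  have := archi_boundP (divr_ge0 c0 (ltW E0)).
  rewrite ltr_pdivrMr// -/K => hK.
  have := Hn K; rewrite ler_pdivlMr// => h1.
  have : D * K%:R <= D * K.+1%:R by rewrite ler_pM2l// ler_nat.
  lra.
pose p (i : nat) : R := a + i%:R * ((b - a) / k.+1%:R).
have p0 : p 0%N = a by rewrite /p mul0r addr0.
have pk : p k.+1 = b by rewrite /p mulrC divfK ?subrKC// pnatr_eq0.
have d0 : 0 <= (b - a) / k.+1%:R by rewrite divr_ge0// subr_ge0.
have pS i : p i.+1 - p i = (b - a) / k.+1%:R.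
  by rewrite /p -natr1; ring.
have pmono i j : (i <= j)%N -> p i <= p j.
  by move=> ij; rewrite /p lerD2l ler_wpM2r// ler_nat.
have -> : E b - E a = \sum_(0 <= i < k.+1) (E (p i.+1) - E (p i)).
  by rewrite (telescope_sumr (fun i => E (p i)))// p0 pk.
apply: le_trans (ler_norm_sum _ _ _) _.
have -> : C * (b - a) * (P b - P a) / k.+1%:R =
  \sum_(0 <= i < k.+1) C * ((b - a) / k.+1%:R) * (P (p i.+1) - P (p i)).
  by rewrite -mulr_sumr (telescope_sumr (fun i => P (p i)))// p0 pk; ring.
rewrite big_nat_cond [leRHS]big_nat_cond; apply: ler_sum => i.
rewrite andbT => /andP[_ ik]; rewrite -(pS i); apply: H.
- by rewrite -p0 pmono.
- exact: pmono.
- by rewrite -pk pmono.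
Qed.

(* Integration by parts where only one factor is differentiable in the
   classical sense: the other one is the primitive of an integrable function. *)
Lemma sint_by_parts a b (l dl F phi : R -> R) : a <= b ->
  continuous l -> continuous dl -> continuous F -> sintegrable a b phi ->
  (forall s t, a <= s -> s <= t -> t <= b -> l t - l s = sint s t dl) ->
  (forall s t, a <= s -> s <= t -> t <= b -> F t - F s = sint s t phi) ->
  l b * F b - l a * F a = sint a b (fun s => dl s * F s + l s * phi s).
Proof.
move=> ab cl cdl cF iphi hl hF.
have [M M0 hM] : exists2 M, 0 <= M & forall s, a <= s <= b -> `|dl s| <= M.
  have cdl' : {within `[a, b], continuous (fun s => `|dl s|)}.
    apply: continuous_subspaceT => x.
    by apply: continuous_comp; [exact: cdl|exact: norm_continuous].
  have [c _ cM] := EVT_max ab cdl'.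
  by exists `|dl c| => // s sab; apply: cM; rewrite in_itv.
pose h s := dl s * F s + l s * phi s.
have ih : sintegrable a b h.
  apply: sintegrableD; apply: sintegrableM => //.
  exact: continuous_sintegrable.
(* [phi] may be unbounded, so the increments of [F] are measured by the primitive of its modulus
   instead of by length. *)
pose P t := sint a t (fun s => `|phi s|).
pose E t := l t * F t - sint a t h.
suff : E a = E b.
  rewrite /E sint_pt subr0 => ->; ring.
apply: (@eq_of_product_modulus E P a b (2 * M)) => // s t as_ st tb.
have iS f : sintegrable a b f -> sintegrable s t f by exact: sintegrableS.
have iSt f : sintegrable a b f -> sintegrable a t f by exact: sintegrableS.
have ip : sintegrable s t phi by exact: iS.
have ipa : sintegrable s t (fun x => `|phi x|) by exact: sintegrable_abs.
have -> : P t - P s = sint s t (fun x => `|phi x|).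
  rewrite /P (@sint_cat a t s) ?as_//; first by rewrite addrAC subrr add0r.
  exact/iSt/sintegrable_abs.
(* Freezing [F] at the right end and [l] at the left end leaves two terms. As [|dl| <= M], each
   integrates to at most [M (t - s) p], whence the factor [2 * M]. *)
have -> : E t - E s = sint s t (fun x => dl x * (F t - F x)
                                         - (l x - l s) * phi x).
  have -> : E t - E s = (l t - l s) * F t + l s * (F t - F s) - sint s t h.
    by rewrite /E (@sint_cat a t s) ?as_//; [ring|exact: iSt].
  rewrite hl// hF// mulrC -!sintZ//; last exact: continuous_sintegrable.
  rewrite -sintD ?sintegrableZ//; last exact: continuous_sintegrable.
  rewrite -sintB; last exact: iS.
    by apply: sint_eq => x _; rewrite /h; ring.
  by apply: sintegrableD; rewrite sintegrableZ//; exact: continuous_sintegrable.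
set p := sint s t (fun x => `|phi x|).
have -> : 2 * M * (t - s) * p = sint s t (fun x => M * p + M * (t - s) * `|phi x|).
  rewrite sintD; first last.
    exact: sintegrableZ.
    by apply: continuous_sintegrable; exact: continuous_fcst.
  by rewrite sint_cst// sintZ// -/p; ring.
apply: sint_abs_le.
- apply: sintegrableB; first apply: continuous_sintegrable.
    apply: continuous_fM => //.
    by apply: continuous_fB => //; exact: continuous_fcst.
  apply: sintegrableM => //.
  by apply: continuous_fB => //; exact: continuous_fcst.
- apply: sintegrableD; last exact: sintegrableZ.
  by apply: continuous_sintegrable; exact: continuous_fcst.
move=> x /andP[sx xt]; apply: le_trans (ler_normB _ _) _.
apply: lerD; rewrite normrM.
  apply: ler_pM => //; first by rewrite hM// (le_trans as_)//= (le_trans xt).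
  rewrite hF//; last exact: le_trans sx.
  have ixt f : sintegrable s t f -> sintegrable x t f by exact: sintegrableS.
  apply: le_trans (sint_abs_le (g := fun x => `|phi x|) _ _ _) _ => //; try exact: ixt.
  rewrite /p (@sint_cat s t x) ?sx//= lerDr; exact: sint_ge0.
apply: ler_wpM2r => //; rewrite hl//; last exact: le_trans tb.
apply: le_trans (sint_abs_le (g := fun=> M) _ _ _) _.
- exact: continuous_sintegrable.
- by apply: continuous_sintegrable; exact: continuous_fcst.
- by move=> y /andP[sy yx]; rewrite hM// (le_trans as_)//= (le_trans yx)// (le_trans xt).
- by rewrite sint_cst// ler_wpM2l// lerD2r.
Qed.

End SegmentIntegral.

(** * Projection onto a segment and global extension of paths *)

Section Clamp.
Context {R : realType}.
Implicit Types (a b t : R).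

Definition clamp a b t : R := Num.max a (Num.min t b).

Lemma clamp_itv a b t : a <= b -> a <= clamp a b t <= b.
Proof. by move=> ab; rewrite /clamp le_max lexx/= ge_max ab ge_min lexx orbT. Qed.

Lemma clamp_id a b t : a <= t <= b -> clamp a b t = t.
Proof. by move=> /andP[a_t tb]; rewrite /clamp (min_idPl tb) (max_idPr a_t). Qed.

Lemma continuous_clamp a b : continuous (clamp a b : R -> R).
Proof.
move=> x; apply: (@continuous_max _ _ (fun=> a) (fun t => Num.min t b)).
  exact: cvg_cst.
by apply: (@continuous_min _ _ id (fun=> b)) => //; exact: cvg_cst.
Qed.

(** Converts continuity in the subspace topology of the segment, which the definitions of trajectory
    and adjoint use, into continuity on the whole line: [clamp a b] is continuous with values in the
    segment. The next lemma goes back. *)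
Lemma within_continuous_clamp (T : topologicalType) a b (f : R -> T) : a <= b ->
  {within `[a, b], continuous f} -> continuous (f \o clamp a b).
Proof.
move=> ab /subspace_continuousP cf x.
have clx : [set` `[a, b]] (clamp a b x) by rewrite /= in_itv/=; exact: clamp_itv.
have := cf _ clx; apply: cvg_comp.
move=> P /= wP; have := @continuous_clamp a b x _ wP.
rewrite !nbhs_simpl/=; apply: filterS => y; apply.
by rewrite /= in_itv/=; exact: clamp_itv.
Qed.

Lemma clamp_within_continuous (T : topologicalType) a b (f : R -> T) :
  continuous (f \o clamp a b) -> {within `[a, b], continuous f}.
Proof.
move=> cf; apply: (@subspace_eq_continuous _ _ _ (f \o clamp a b)).
  by move=> x; rewrite inE/= in_itv/= => /clamp_id/= ->.
exact: continuous_subspaceT.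
Qed.

End Clamp.
Arguments continuous_clamp {R} a b x.
Arguments within_continuous_clamp {R T} a b f ab cf x : rename.

(** * Primitives, exponential weights, Gronwall's inequality, almost everywhere differentiation *)

Section SegmentPrimitive.
Context {R : realType}.
Notation mu := (@lebesgue_measure R).
Implicit Types (a b : R) (f F : R -> R).

Lemma continuous_sint_clamp a b f : a <= b -> sintegrable a b f ->
  continuous (fun t => sint a (clamp a b t) f).
Proof.
move=> ab fi.
exact: (within_continuous_clamp _ _ _ ab (parameterized_integral_continuous ab fi)).
Qed.

(** Derivatives are required in the open interval only, which is what the adjoint equation supplies;
    continuity takes care of the end points. *)
Lemma sint_derivable a b f F : continuous f ->
  {within `[a, b], continuous F} ->
  (forall s, s \in `]a, b[ -> derivable F s 1 /\ derive1 F s = f s) ->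
  forall s t, a <= s -> s <= t -> t <= b -> F t - F s = sint s t f.
Proof.
move=> cf cF dF s t as_; rewrite le_eqVlt => /predU1P[->|st] tb.
  by rewrite sint_pt subrr.
have sub : [set` `]s, t[] `<=` [set` `]a, b[] by apply: subset_itv; rewrite bnd_simp.
have cF' : {within `[s, t], continuous F}.
  by apply: continuous_subspaceW cF; apply: subset_itv; rewrite bnd_simp.
have [_ cs ct] := (continuous_within_itvP F st).1 cF'.
rewrite /sint /Rintegral (@continuous_FTC2 _ f F s t)//.
- exact: continuous_subspaceT.
- by split => // x xst; have [] := dF x (sub _ xst).
- by move=> x xst; have [] := dF x (sub _ xst).
Qed.

Lemma continuous_expR_shift (k a : R) : continuous (fun s : R => expR (k * (s - a))).
Proof.
have ca : continuous (fun s : R => k * (s - a)).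
  apply: (@continuous_fM _ (fun=> k)); first exact: continuous_fcst.
  by apply: (@continuous_fB _ id (fun=> a)); [move=> ?; exact: cvg_id|exact: continuous_fcst].
move=> s; apply: (@continuous_comp _ _ _ (fun s : R => k * (s - a)) expR).
  exact: ca.
exact: continuous_expR.
Qed.

Lemma sint_expR (L a b : R) : a <= b -> 0 < L ->
  sint a b (fun s => expR (2 * L * (s - a)))
  = (expR (2 * L * (b - a)) - 1) / (2 * L).
Proof.
move=> ab L0.
have dF (x : R) : is_derive x 1 (fun s => (2 * L)^-1 * expR (2 * L * (s - a)))
   (expR (2 * L * (x - a))).
  have h : is_derive x 1 (fun s : R => 2 * L * (s - a)) (2 * L).
    apply: is_derive_eq; rewrite /GRing.scale/=; ring.
  have d1 := is_derive1_comp (is_derive_expR _) h.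
  have d2 := is_deriveZ (2 * L)^-1 d1.
  apply: is_derive_eq d2 _.
  by rewrite /GRing.scale/= mulrCA mulVf ?mulr1// mulf_neq0// gt_eqF.
rewrite -(@sint_derivable a b (fun s => expR (2 * L * (s - a)))
   (fun s => (2 * L)^-1 * expR (2 * L * (s - a))))//.
- by rewrite subrr mulr0 expR0; field; lra.
- exact: continuous_expR_shift.
- apply: continuous_subspaceT => x; apply: differentiable_continuous.
  by apply/derivable1_diffP; case: (dF x).
- by move=> s _; rewrite derive1E; case: (dF s).
Qed.

(* The maximum [M] of [phi(s) exp(- 2 L (s - a))] satisfies [M <= g + M / 2];
   this is why the exponent carries a factor [2]. *)
Lemma gronwall a b (L g : R) (phi : R -> R) : a <= b -> 0 < L ->
  continuous phi -> (forall t, a <= t <= b -> 0 <= phi t) ->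
  (forall t, a <= t <= b -> phi t <= g + L * sint a t phi) ->
  forall t, a <= t <= b -> phi t <= 2 * g * expR (2 * L * (t - a)).
Proof.
move=> ab L0 cphi phi0 H.
pose w s := expR (2 * L * (s - a)).
have w0 s : 0 < w s by exact: expR_gt0.
have cw k := @continuous_expR_shift k a.
pose q s := expR (- (2 * L) * (s - a)) * phi s.
have phiq s : phi s = q s * w s.
  rewrite /q mulrAC -expRD (_ : _ + _ = 0) ?expR0 ?mul1r//; ring.
have cq : {within `[a, b], continuous q}.
  by apply: continuous_subspaceT; exact: continuous_fM.
have [c cab qc] := EVT_max ab cq.
have {}cab : a <= c <= b by move: cab; rewrite in_itv.
have q0 : 0 <= q c by rewrite mulr_ge0 ?phi0 ?expR_ge0.
have /andP[ac cb] := cab.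
have h : q c * w c <= g + L * (q c * ((w c - 1) / (2 * L))).
  rewrite -phiq; apply: le_trans (H _ cab) _.
  rewrite lerD2l (ler_pM2l L0) -(sint_expR ac L0).
  rewrite -(@sintZ _ a c (q c) (fun s => expR (2 * L * (s - a)))); last first.
    by apply: continuous_sintegrable; exact: cw.
  apply: sint_le; [exact: continuous_sintegrable| |].
    by apply: sintegrableZ; apply: continuous_sintegrable; exact: cw.
  move=> s /andP[as_ sc]; rewrite phiq ler_wpM2r ?expR_ge0//; apply: qc.
  by rewrite in_itv/= as_ (le_trans sc).
have {}h : q c * w c <= g + q c * (w c - 1) / 2.
  by apply: le_trans h _; rewrite lerD2l le_eqVlt; apply/orP; left; apply/eqP; field; lra.
have w1 : 1 <= w c.
  rewrite -[leLHS]expR0 ler_expR mulr_ge0 ?subr_ge0//; lra.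
(* [h] rearranges to [q c * (w c + 1) <= 2 * g]. *)
have qg : q c <= 2 * g by nra.
move=> t tab; rewrite phiq ler_wpM2r ?expR_ge0//.
by apply: le_trans qg; apply: qc; rewrite in_itv.
Qed.

Import HBNNSimple.

(* No measurability of [f] is assumed: the derivative of a trajectory is only
   controlled almost everywhere. *)
Lemma integral_ae0 (D : set R) (f : R -> R) : measurable D ->
  {ae mu, forall x, D x -> f x = 0} -> \int[mu]_(x in D) f x = 0.
Proof.
move=> mD [N [mN N0 subN]].
suff H (g : R -> \bar R) : (forall x, 0 <= g x)%E ->
    (forall x, D x -> ~ N x -> g x = 0%E) -> (\int[mu]_(x in D) g x = 0)%E.
  rewrite /Rintegral integralE !H ?sube0//.
  - move=> x Dx Nx; rewrite funenegE.
    have -> : f x = 0 by apply: contrapT => fx; apply: Nx; apply: subN => /(_ Dx).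
    by rewrite oppe0 maxxx.
  - move=> x Dx Nx; rewrite funeposE.
    have -> : f x = 0 by apply: contrapT => fx; apply: Nx; apply: subN => /(_ Dx).
    by rewrite maxxx.
move=> g0 gN; apply/eqP; rewrite eq_le integral_ge0// andbT.
(* The integral of a nonnegative function is a supremum over simple functions below it. These are
   measurable whatever [g] is, and here each of them is 0 on the domain off the null set [N]. *)
rewrite ge0_integralE//; apply: ge_ereal_sup => _ [h /= hg <-].
have := integral_nnsfun mu measurableT h; rewrite patch_setT => <-.
rewrite (ge0_negligible_integral mN _ _ _ N0)//; last 2 first.
  exact/measurable_EFinP.
  by move=> x _; rewrite lee_fin.
rewrite integral0_eq// => x [_ Nx].
apply/eqP; rewrite eq_le; apply/andP; split; last by rewrite lee_fin.
apply: le_trans (hg x) _; rewrite patchE; case: ifPn => // /set_mem Dx.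
by rewrite gN.
Qed.

Lemma ae_derivable_sint a b f : sintegrable a b f ->
  {ae mu, forall x, a < x < b ->
     derivable (fun t => sint a t f) x 1 /\ derive1 (fun t => sint a t f) x = f x}.
Proof.
(* Extended by 0, [f] is integrable up to any end point, as [FTC1] asks. *)
move=> fi; pose g := f \_ `[a, b].
have gi (A : set R) : measurable A -> mu.-integrable A (EFin \o g).
  move=> mA; rewrite /g -restrict_EFin; apply/integrable_restrict => //.
  by apply: integrableS fi => //; exact: measurableI.
have := FTC1 (a := BLeft a) (fun y => gi _ _) (integrable_locally _ fi).
move=> /(_ (fun=> ltac:(done)) ltac:(done)).
apply: filterS; first exact: (ae_filter_ringOfSetsType mu).
move=> x + /andP[ax xb].
move=> /(_ ltac:(by rewrite /= lte_fin)).
have E : {near x, (fun y => \int[mu]_(t in `[a, y]) g t) =1 (fun t => sint a t f)}.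
  near=> y; apply: sint_eq => s /andP[as_ sy]; rewrite /g patchE ifT// inE/= in_itv/=.
  rewrite as_ (le_trans sy)//; apply/ltW; near: y; exact: lt_nbhsl.
move=> [d1 d2]; split; first exact: (@near_eq_derivable _ _ _ _ _ _ _ E d1).
rewrite derive1E -(near_eq_derive _ E) -derive1E d2 /g patchE ifT// inE/= in_itv/= !ltW//.
Unshelve. all: by end_near. Qed.

End SegmentPrimitive.

(** * Matrix-valued paths *)

Section MatrixNorm.
Context {R : realType}.

Lemma mx_entry_le m n (A : 'M[R]_(m, n)) i j : `|A i j| <= `|A|.
Proof.
rewrite [leRHS]/Num.norm/= mx_normrE.
exact: (@le_bigmax _ _ _ _ (fun ij => `|A ij.1 ij.2|) (i, j)).
Qed.

Lemma mx_norm_le m n (A : 'M[R]_(m, n)) c : 0 <= c ->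
  (forall i j, `|A i j| <= c) -> `|A| <= c.
Proof.
move=> c0 Ac; rewrite [leLHS]/Num.norm/= mx_normrE.
by apply: bigmax_le => // -[i j] _; exact: Ac.
Qed.

(** The norm is the largest modulus of an entry, which is submultiplicative only up to the inner
    dimension. *)
Lemma mulmx_norm_le m n p (A : 'M[R]_(m, n)) (B : 'M[R]_(n, p)) :
  `|A *m B| <= n%:R * `|A| * `|B|.
Proof.
apply: mx_norm_le => [|i j]; first by rewrite !mulr_ge0.
rewrite mxE; apply: le_trans (ler_norm_sum _ _ _) _.
have -> : n%:R * `|A| * `|B| = \sum_(k < n) `|A| * `|B|.
  by rewrite sumr_const card_ord -[RHS]mulr_natl mulrA.
by apply: ler_sum => k _; rewrite normrM ler_pM ?mx_entry_le.
Qed.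

Lemma trmx_norm_le m n (A : 'M[R]_(m, n)) : `|A^T| <= `|A|.
Proof. by apply: mx_norm_le => // i j; rewrite mxE mx_entry_le. Qed.

End MatrixNorm.

Section MatrixPath.
Context {R : realType}.

(** Entrywise, so that the scalar lemmas on integrals apply directly; [continuous_mx_cont] and
    [mx_cont_continuous] relate it to continuity in norm. *)
Definition mx_cont m n (f : R -> 'M[R]_(m, n)) :=
  forall i j, continuous (fun s => f s i j).

Definition mx_integrable m n (a b : R) (f : R -> 'M[R]_(m, n)) :=
  forall i j, sintegrable a b (fun s => f s i j).

Lemma continuous_mx_cont m n (f : R -> 'M[R]_(m, n)) :
  continuous f -> mx_cont f.
Proof.
move=> cf i j s.
apply: (@continuous_comp _ _ _ f (fun M : 'M[R]_(m, n) => M i j)).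
  exact: cf.
exact: coord_continuous.
Qed.

Lemma mx_cont_near m n (f : R -> 'M[R]_(m, n)) s (e : R) : mx_cont f -> 0 < e ->
  \forall t \near s, `|f s - f t| <= e.
Proof.
move=> cf e0.
have H : \forall t \near s, forall ij : 'I_m * 'I_n,
    `|f s ij.1 ij.2 - f t ij.1 ij.2| <= e.
  apply: (@filter_forall _ _ _ (nbhs s)) => -[i j] /=.
  by have /cvgrPdist_le/(_ _ e0) := cf i j s.
near=> t; apply: mx_norm_le; first exact: ltW.
by move=> i j; rewrite !mxE; exact: (near H t _ (i, j)).
Unshelve. all: by end_near. Qed.

Lemma mx_cont_continuous m n (f : R -> 'M[R]_(m, n)) :
  mx_cont f -> continuous f.
Proof.
by move=> cf s; apply/cvgrPdist_le => e e0; exact: mx_cont_near.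
Qed.

Lemma mx_cont_norm m n (f : R -> 'M[R]_(m, n)) :
  mx_cont f -> continuous (fun s => `|f s|).
Proof.
move=> cf s; apply/cvgrPdist_le => e e0; near=> t.
apply: le_trans (ler_dist_dist _ _) _; near: t; exact: mx_cont_near.
Unshelve. all: by end_near. Qed.

Lemma mx_cont_cst m n (A : 'M[R]_(m, n)) : mx_cont (fun=> A).
Proof. by move=> i j; exact: continuous_fcst. Qed.

Lemma mx_contD m n (f g : R -> 'M[R]_(m, n)) : mx_cont f -> mx_cont g ->
  mx_cont (fun s => f s + g s).
Proof.
move=> cf cg i j; under eq_fun do rewrite mxE.
exact: continuous_fD (cf i j) (cg i j).
Qed.

Lemma mx_contM m n p (f : R -> 'M[R]_(m, n)) (g : R -> 'M[R]_(n, p)) :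
  mx_cont f -> mx_cont g -> mx_cont (fun s => f s *m g s).
Proof.
move=> cf cg i j; under eq_fun do rewrite mxE.
by apply: continuous_fsum => k _; exact: continuous_fM (cf i k) (cg k j).
Qed.

Lemma mx_cont_tr m n (f : R -> 'M[R]_(m, n)) : mx_cont f ->
  mx_cont (fun s => (f s)^T).
Proof. by move=> cf i j; under eq_fun do rewrite mxE; exact: cf. Qed.

Lemma mx_cont_integrable m n a b (f : R -> 'M[R]_(m, n)) :
  mx_cont f -> mx_integrable a b f.
Proof. by move=> cf i j; exact: continuous_sintegrable. Qed.

Lemma mx_integrableS m n a b c d (f : R -> 'M[R]_(m, n)) : a <= c -> d <= b ->
  mx_integrable a b f -> mx_integrable c d f.
Proof. by move=> ac db fi i j; exact: sintegrableS (fi i j). Qed.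

Lemma mx_integrableD m n a b (f g : R -> 'M[R]_(m, n)) :
  mx_integrable a b f -> mx_integrable a b g ->
  mx_integrable a b (fun s => f s + g s).
Proof.
move=> fi gi i j.
apply: sintegrable_eq (sintegrableD (fi i j) (gi i j)) => s _; by rewrite mxE.
Qed.

Lemma mx_integrableB m n a b (f g : R -> 'M[R]_(m, n)) :
  mx_integrable a b f -> mx_integrable a b g ->
  mx_integrable a b (fun s => f s - g s).
Proof.
move=> fi gi i j.
apply: sintegrable_eq (sintegrableB (fi i j) (gi i j)) => s _; by rewrite !mxE.
Qed.

Lemma mx_integrableM m n p a b (f : R -> 'M[R]_(m, n)) (g : R -> 'M[R]_(n, p)) :
  mx_cont f -> mx_integrable a b g ->
  mx_integrable a b (fun s => f s *m g s).
Proof.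
move=> cf gi i j; apply: (@sintegrable_eq _ _ _
  (fun s => \sum_k f s i k * g s k j)); first by move=> s _; rewrite mxE.
by apply: sintegrable_sum => k _; apply: sintegrableM.
Qed.

Lemma mx_integrable_tr m n a b (f : R -> 'M[R]_(m, n)) :
  mx_integrable a b f -> mx_integrable a b (fun s => (f s)^T).
Proof.
by move=> fi i j; apply: sintegrable_eq (fi j i) => s _; rewrite mxE.
Qed.

Lemma mx_integralE m n a b (f : R -> 'M[R]_(m, n)) i j :
  mx_integral a b f i j = sint a b (fun s => f s i j).
Proof. by rewrite mxE. Qed.

Lemma mx_integral_eq m n a b (f g : R -> 'M[R]_(m, n)) :
  (forall s, a <= s <= b -> f s = g s) -> mx_integral a b f = mx_integral a b g.
Proof.
move=> fg; apply/matrixP => i j; rewrite !mx_integralE.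
by apply: sint_eq => s sab; rewrite fg.
Qed.

Lemma mx_integral_pt m n a (f : R -> 'M[R]_(m, n)) : mx_integral a a f = 0.
Proof. by apply/matrixP => i j; rewrite mx_integralE sint_pt mxE. Qed.

Lemma mx_integralD m n a b (f g : R -> 'M[R]_(m, n)) :
  mx_integrable a b f -> mx_integrable a b g ->
  mx_integral a b (fun s => f s + g s) = mx_integral a b f + mx_integral a b g.
Proof.
move=> fi gi; apply/matrixP => i j; rewrite [RHS]mxE !mx_integralE -sintD//.
by apply: sint_eq => s _; rewrite mxE.
Qed.

Lemma mx_integralB m n a b (f g : R -> 'M[R]_(m, n)) :
  mx_integrable a b f -> mx_integrable a b g ->
  mx_integral a b (fun s => f s - g s) = mx_integral a b f - mx_integral a b g.
Proof.
move=> fi gi; apply/matrixP => i j; rewrite mx_integralE [RHS]mxE.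
rewrite [X in _ = _ + X]mxE !mx_integralE -sintB//; by apply: sint_eq => s _; rewrite !mxE.
Qed.

Lemma mx_integral_cat m n a b c (f : R -> 'M[R]_(m, n)) : a <= c <= b ->
  mx_integrable a b f ->
  mx_integral a b f = mx_integral a c f + mx_integral c b f.
Proof.
move=> acb fi; apply/matrixP => i j; rewrite [RHS]mxE !mx_integralE.
exact: sint_cat.
Qed.

Lemma mx_integral_norm_le m n a b (f : R -> 'M[R]_(m, n)) (g : R -> R) :
  mx_integrable a b f -> sintegrable a b g ->
  (forall s, a <= s <= b -> `|f s| <= g s) ->
  `|mx_integral a b f| <= sint a b g.
Proof.
move=> fi gi fg; apply: mx_norm_le.
  by apply: sint_ge0 => s /fg; exact: le_trans.
move=> i j; rewrite mx_integralE; apply: sint_abs_le => // s /fg.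
exact/le_trans/mx_entry_le.
Qed.

Lemma mx_cont_integral_clamp m n a b (f : R -> 'M[R]_(m, n)) : a <= b ->
  mx_integrable a b f -> mx_cont (fun t => mx_integral a (clamp a b t) f).
Proof.
move=> ab fi i j; under eq_fun do rewrite mx_integralE.
exact: continuous_sint_clamp.
Qed.

Lemma mx_cont_bounded m n a b (f : R -> 'M[R]_(m, n)) : a <= b -> mx_cont f ->
  exists2 M, 0 <= M & forall s, a <= s <= b -> `|f s| <= M.
Proof.
move=> ab cf.
have cf' : {within `[a, b], continuous (fun s => `|f s|)}.
  by apply: continuous_subspaceT; exact: mx_cont_norm.
have [c _ cM] := EVT_max ab cf'.
by exists `|f c| => // s sab; apply: cM; rewrite in_itv.
Qed.

End MatrixPath.
Arguments mx_cont_cst {R m n} A i j x.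

(** * Picard iteration *)

Section Picard.
Context {R : realType}.

(** Replaces passing to the limit in the iteration; it rests on the Archimedean property and
    [k < 2 ^ k]. *)
Lemma le0_geometric (x C : R) : (forall k, x <= C / 2 ^+ k) -> x <= 0.
Proof.
move=> H; rewrite leNgt; apply/negP => x0.
have C0 : 0 <= C by have := H 0%N; rewrite expr0 divr1; lra.
have := archi_boundP (divr_ge0 C0 (ltW x0)).
set k := Num.bound _ => hk; have := H k.
rewrite ler_pdivlMr ?exprn_gt0//; move: hk; rewrite ltr_pdivrMr// => h1 h2.
have : x * k%:R <= x * 2 ^+ k.
  by rewrite ler_pM2l// -natrX ler_nat ltnW// ltn_expl.
lra.
Qed.

(** The intervals of radius [2 C / 2^k] around [x k] are nested: from [k] to [k + 1] the radius
    shrinks by [C / 2^k], and the centre moves by no more than that. The limit is the supremum of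
    the lower ends. *)
Lemma geometric_limit (x : nat -> R) (C : R) :
  (forall k, `|x k.+1 - x k| <= C / 2 ^+ k) ->
  exists l, forall k, `|l - x k| <= 2 * C / 2 ^+ k.
Proof.
move=> H.
have half k : C / 2 ^+ k.+1 = C / 2 ^+ k / 2 by rewrite exprSr invfM mulrA.
have C0 k : 0 <= C / 2 ^+ k by apply: le_trans (H k).
pose y k := x k - 2 * (C / 2 ^+ k); pose z k := x k + 2 * (C / 2 ^+ k).
have yS k : y k <= y k.+1.
  by rewrite /y half; have := H k; rewrite ler_norml => /andP[]; lra.
have zS k : z k.+1 <= z k.
  by rewrite /z half; have := H k; rewrite ler_norml => /andP[]; lra.
have ym i j : (i <= j)%N -> y i <= y j.
  by apply: (@homo_leq _ y <=%R) => //; exact: le_trans.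
have zm i j : (i <= j)%N -> z j <= z i.
  by apply: (@homo_leq _ z (fun a b => b <= a)) => // a b c ab /le_trans; apply.
have yz i j : y i <= z j.
  apply: (le_trans (ym _ _ (leq_maxl i j))).
  apply: (le_trans _ (zm _ _ (leq_maxr i j))).
  by rewrite /y /z; have := C0 (maxn i j); lra.
have ub j : ubound (range y) (z j) by move=> _ [i _ <-].
exists (sup (range y)) => k.
have y0 : range y !=set0 by exists (y 0%N); exists 0%N.
have h1 : y k <= sup (range y).
  by apply: ub_le_sup; [exists (z 0%N); exact: ub|exists k].
have h2 : sup (range y) <= z k by apply: ge_sup.
by rewrite ler_norml -mulrA; rewrite /y /z in h1 h2; apply/andP; split; lra.
Qed.

Lemma uniform_approx_continuous (f : R -> R) :
  (forall e, 0 < e -> exists2 v, continuous v & forall t, `|f t - v t| <= e) ->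
  continuous f.
Proof.
move=> H s; apply/cvgrPdist_le => e e0.
have e3 : 0 < e / 3 by rewrite divr_gt0.
have [v cv fv] := H _ e3.
have /cvgrPdist_le/(_ _ e3) := cv s; apply: filterS => t.
have := fv s; have := fv t; rewrite !ler_norml => /andP[? ?] /andP[? ?] /andP[? ?].
by apply/andP; split; lra.
Qed.

(* With the weight [exp(2 L (t - a))] the iteration contracts by [1 / 2], so no
   subdivision of [[a, b]] is needed. *)
Lemma picard r (a b L : R) (g : R -> 'cV[R]_r) (G : R -> 'cV[R]_r -> 'cV[R]_r) :
  a <= b -> 0 < L -> mx_cont g ->
  (forall v, mx_cont v -> mx_cont (fun s => G s (v s))) ->
  (forall s x y, `|G s x - G s y| <= L * `|x - y|) ->
  exists2 w, mx_cont w &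
    forall t, a <= t <= b -> w t = g t + mx_integral a t (fun s => G s (w s)).
Proof.
move=> ab L0 cg cG lG.
(* With the upper limit clamped, the iterates are continuous on the whole line and their successive
   differences are bounded there, so the estimates hold for every [t]. *)
pose P (v : R -> 'cV[R]_r) t :=
  g t + mx_integral a (clamp a b t) (fun s => G s (v s)).
have cP v : mx_cont v -> mx_cont (P v).
  move=> cv; apply: mx_contD => //; apply: mx_cont_integral_clamp => //.
  by apply: mx_cont_integrable; exact: cG.
pose w_ k := iter k P g.
have cw k : mx_cont (w_ k) by elim: k => //= k; exact: cP.
have wSE k t : w_ k.+1 t = P (w_ k) t by [].
have iG (v : R -> 'cV[R]_r) x y : mx_cont v -> mx_integrable x y (fun s => G s (v s)).
  by move=> cv; apply: mx_cont_integrable; exact: cG.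
have [c c0 hc] : exists2 c, 0 <= c & forall t, `|w_ 1%N t - w_ 0%N t| <= c.
  have [c c0 hc] := mx_cont_bounded ab (mx_cont_integral_clamp ab (iG g a b cg)).
  exists c => // t; rewrite wSE /P addrAC subrr add0r.
  by have := hc _ (clamp_itv t ab); rewrite (clamp_id (clamp_itv t ab)).
pose E (t : R) := expR (2 * L * (t - a)).
have cE : continuous E by exact: continuous_expR_shift.
have diff k t : `|w_ k.+1 t - w_ k t| <= c / 2 ^+ k * E (clamp a b t).
  elim: k t => [|k IH] t.
    rewrite expr0 divr1; apply: le_trans (hc t) _; rewrite ler_peMr//.
    have /andP[h _] := clamp_itv t ab.
    by rewrite /E -[leLHS]expR0 ler_expR mulr_ge0 ?subr_ge0//; lra.
  rewrite 2!wSE /P opprD addrACA subrr add0r -mx_integralB; try exact: iG.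
  have /andP[h1 h2] := clamp_itv t ab.
  apply: le_trans (mx_integral_norm_le
    (g := fun s => L * (c / 2 ^+ k) * E s) _ _ _) _.
  - by apply: mx_integrableB; exact: iG.
  - by apply: sintegrableZ; exact: continuous_sintegrable.
  - move=> s /andP[as_ st]; apply: le_trans (lG _ _ _) _.
    rewrite -[leRHS]mulrA ler_wpM2l ?(ltW L0)//; apply: le_trans (IH s) _.
    by rewrite clamp_id// as_ (le_trans st).
  - rewrite sintZ; last exact: continuous_sintegrable.
    rewrite sint_expR// exprSr invfM.
    set F := expR _; rewrite [leLHS](_ : _ = c / 2 ^+ k * (F - 1) / 2); last first.
      by field; rewrite expf_neq0 ?gt_eqF.
    rewrite [leRHS](_ : _ = c / 2 ^+ k * F / 2); last by rewrite /F /E; field; rewrite expf_neq0.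
    have ck : 0 <= c / 2 ^+ k by rewrite divr_ge0 ?exprn_ge0.
    rewrite ler_wpM2r ?invr_ge0// ler_wpM2l//; lra.
pose C := c * E b.
have diffC k t i : `|w_ k.+1 t i 0 - w_ k t i 0| <= C / 2 ^+ k.
  have := mx_entry_le (w_ k.+1 t - w_ k t) i 0; rewrite !mxE => /le_trans; apply.
  apply: le_trans (diff k t) _; rewrite /C [leRHS]mulrAC ler_wpM2l ?divr_ge0 ?exprn_ge0//.
  have /andP[h1 h2] := clamp_itv t ab.
  rewrite /E ler_expR ler_wpM2l ?lerD2r//; lra.
have /boolp.choice[l hl] : forall ti : R * 'I_r, exists l : R,
    forall k, `|l - w_ k ti.1 ti.2 0| <= 2 * C / 2 ^+ k.
  by move=> [t i]; apply: geometric_limit => k; exact: diffC.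
pose w t : 'cV[R]_r := \col_i l (t, i).
have C0 : 0 <= C by rewrite mulr_ge0// expR_ge0.
have C2 k : 0 <= 2 * C / 2 ^+ k by rewrite divr_ge0 ?exprn_ge0 // mulr_ge0.
have wk t k : `|w t - w_ k t| <= 2 * C / 2 ^+ k.
  apply: mx_norm_le => // i j; rewrite !mxE ord1; exact: (hl (t, i) k).
have cvw : mx_cont w.
  move=> i j; rewrite ord1; apply: uniform_approx_continuous => e e0.
  have [k hk] : exists k, 2 * C / 2 ^+ k <= e.
    apply: contrapT => /forallNP hk.
    have : e <= 0.
      apply: (@le0_geometric _ (2 * C)) => k.
      by rewrite ltW// ltNge; apply/negP; exact: hk.
    lra.
  exists (fun t => w_ k t i 0); first exact: cw.
  by move=> t; rewrite mxE; apply: le_trans hk; exact: (hl (t, i) k).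
exists w => // t tab; apply/eqP; rewrite -subr_eq0 -normr_le0.
have /andP[a_t tb] := tab.
(* The iterate [w_ k.+1] is inserted: [C] accounts for its distance to [w], the other summand for
   the integral of [G s (w_ k s) - G s (w s)]. *)
apply: (@le0_geometric _ (C + (b - a) * L * (2 * C))) => k.
rewrite [X in `|X|](_ : _ = (w t - w_ k.+1 t)
   + mx_integral a t (fun s => G s (w_ k s) - G s (w s))); last first.
  rewrite mx_integralB; try exact: iG.
  by rewrite wSE /P clamp_id// !opprD !addrA subrK.
apply: le_trans (ler_normD _ _) _; rewrite mulrDl lerD//.
  apply: le_trans (wk t k.+1) _; rewrite exprSr invfM le_eqVlt; apply/orP; left.
  by apply/eqP; field; rewrite expf_neq0.
apply: le_trans (mx_integral_norm_le
    (g := fun s => L * (2 * C / 2 ^+ k)) _ _ _) _.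
- by apply: mx_integrableB; exact: iG.
- by apply: continuous_sintegrable; exact: continuous_fcst.
- move=> s _; apply: le_trans (lG _ _ _) _.
  by rewrite ler_wpM2l ?(ltW L0)// distrC.
- rewrite sint_cst// [leRHS](_ : _ = L * (2 * C / 2 ^+ k) * (b - a)); last by ring.
  by rewrite ler_wpM2l ?lerD2r// mulr_ge0// ltW.
Qed.

End Picard.

(** * Perturbation of trajectories *)

Section Contraction.
Context {R : realType} {r : nat}.
Implicit Types (H : tensor R r) (x y z : 'cV[R]_r).

(** The bilinear form behind the quadratic term. [H] is not assumed symmetric in its last two
    indices, so the two slots are kept apart and the derivative has two terms. *)
Definition contract2 H x y : 'cV[R]_r :=
  \col_i \sum_(p < r) \sum_(q < r) tentry H i p q * x p 0 * y q 0.

Lemma contractE H z : Defs.contract H z = contract2 H z z.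
Proof. by []. Qed.

Lemma tentryE H i p q : tentry H i p q = H q (mxvec_index i p).
Proof. by rewrite /tentry /slice mxE mxE. Qed.

Lemma contract2DT H H' x y :
  contract2 (H + H') x y = contract2 H x y + contract2 H' x y.
Proof.
apply/colP => i; rewrite !mxE -big_split/=; apply: eq_bigr => p _.
rewrite -big_split/=; apply: eq_bigr => q _.
by rewrite !tentryE mxE; ring.
Qed.

Lemma contract2Dl H x y z : contract2 H (x + y) z = contract2 H x z + contract2 H y z.
Proof.
apply/colP => i; rewrite !mxE -big_split/=; apply: eq_bigr => p _.
by rewrite -big_split/=; apply: eq_bigr => q _; rewrite mxE; ring.
Qed.

Lemma contract2Dr H x y z : contract2 H x (y + z) = contract2 H x y + contract2 H x z.
Proof.
apply/colP => i; rewrite !mxE -big_split/=; apply: eq_bigr => p _.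
by rewrite -big_split/=; apply: eq_bigr => q _; rewrite mxE; ring.
Qed.

Lemma contract2Nl H x z : contract2 H (- x) z = - contract2 H x z.
Proof.
apply/colP => i; rewrite !mxE -sumrN; apply: eq_bigr => p _.
by rewrite -sumrN; apply: eq_bigr => q _; rewrite mxE; ring.
Qed.

Lemma contract2Nr H x z : contract2 H x (- z) = - contract2 H x z.
Proof.
apply/colP => i; rewrite !mxE -sumrN; apply: eq_bigr => p _.
by rewrite -sumrN; apply: eq_bigr => q _; rewrite mxE; ring.
Qed.

Lemma contract2_norm_le H x y :
  `|contract2 H x y| <= r%:R * r%:R * `|H| * `|x| * `|y|.
Proof.
apply: mx_norm_le => [|i j]; first by rewrite !mulr_ge0.
rewrite mxE; apply: le_trans (ler_norm_sum _ _ _) _.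
have -> : r%:R * r%:R * `|H| * `|x| * `|y| =
    \sum_(p < r) \sum_(q < r) `|H| * `|x| * `|y|.
  by rewrite !sumr_const !card_ord -[RHS]mulr_natl -[X in _ = _ * X]mulr_natl !mulrA.
apply: ler_sum => p _; apply: le_trans (ler_norm_sum _ _ _) _.
apply: ler_sum => q _; rewrite !normrM tentryE.
by rewrite !ler_pM ?mulr_ge0 ?mx_entry_le.
Qed.

Lemma mx_cont_contract2 H (f g : R -> 'cV[R]_r) : mx_cont f -> mx_cont g ->
  mx_cont (fun s => contract2 H (f s) (g s)).
Proof.
move=> cf cg i j; under eq_fun do rewrite mxE.
apply: continuous_fsum => p _; apply: continuous_fsum => q _.
apply: (continuous_fM (fun s => tentry H i p q * f s p 0) (fun s => g s q 0)) => //.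
by apply: (continuous_fM (fun=> tentry H i p q) (fun s => f s p 0)) => //;
  exact: continuous_fcst.
Qed.

(** An exact identity, as the field is quadratic in the state. The grouping anticipates [picard]:
    the first bracket integrates to the continuous function [g], the second is continuous and
    vanishes with [w], and becomes [G] after clipping. *)
Lemma red_field_perturb m (A dA : 'M[R]_r) H (dH : tensor R r) (B dB : 'M[R]_(r, m)) x w u :
  red_field (A + dA) (H + dH) (B + dB) (x + w) u =
  red_field A H B x u + (dA *m x + contract2 dH x x + dB *m u)
  + ((A + dA) *m w + contract2 (H + dH) x w + contract2 (H + dH) w x
     + contract2 (H + dH) w w).
Proof.
rewrite /red_field !contractE.
rewrite contract2Dl 2!contract2Dr contract2DT mulmxDr.
rewrite [(A + dA) *m x]mulmxDl [(B + dB) *m u]mulmxDl.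
move: (A *m x) (dA *m x) (contract2 H x x) (contract2 dH x x) (B *m u) (dB *m u)
  ((A + dA) *m w) (contract2 (H + dH) x w) (contract2 (H + dH) w x)
  (contract2 (H + dH) w w) => a1 a2 a3 a4 a5 a6 a7 a8 a9 a10.
by apply/matrixP => i j; rewrite !mxE; ring.
Qed.

End Contraction.

Section Clip.
Context {R : realType} {r : nat}.
Implicit Types x y : 'cV[R]_r.

(* Clipping the perturbation makes the quadratic field globally Lipschitz, and has
   no effect on solutions bounded by [1]. *)
Definition clip x : 'cV[R]_r := \col_i clamp (-1) 1 (x i 0).

Lemma clamp_lipschitz (a b s t : R) : `|clamp a b s - clamp a b t| <= `|s - t|.
Proof.
have h1 := normr_ge0 (s - t); have h2 := ler_norm (s - t).
have h3 := ler_norm (t - s); rewrite distrC in h3.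
by rewrite /clamp; case: (leP s b) => ?; case: (leP t b) => ?;
  rewrite ler_norml; case: (leP a s) => ?; case: (leP a t) => ?; case: (leP a b) => ?;
  apply/andP; split; lra.
Qed.

Lemma clip_lipschitz x y : `|clip x - clip y| <= `|x - y|.
Proof.
apply: mx_norm_le => // i j; rewrite !mxE.
apply: le_trans (clamp_lipschitz _ _ _ _) _.
by have := mx_entry_le (x - y) i 0; rewrite !mxE.
Qed.

Lemma clip_norm_le x : `|clip x| <= 1.
Proof.
apply: mx_norm_le => // i j; rewrite !mxE ler_norml; apply: clamp_itv; lra.
Qed.

Lemma clip_id x : `|x| <= 1 -> clip x = x.
Proof.
move=> x1; apply/colP => i; rewrite mxE clamp_id// -ler_norml.
exact: le_trans (mx_entry_le _ _ _) x1.
Qed.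

Lemma mx_cont_clip (f : R -> 'cV[R]_r) : mx_cont f -> mx_cont (fun s => clip (f s)).
Proof.
move=> cf i j; under eq_fun do rewrite mxE.
move=> s; apply: (@continuous_comp _ _ _ (fun s => f s i 0) (clamp (-1) 1)).
  exact: cf.
exact: continuous_clamp.
Qed.

End Clip.

(** * Uniqueness and Lipschitz dependence for the integral equation *)

Section Solutions.
Context {R : realType} {r m : nat}.
Variables (a b : R) (u : R -> 'cV[R]_m).
Hypotheses (ab : a <= b) (iu : mx_integrable a b u).
Implicit Types (A : 'M[R]_r) (H : tensor R r) (B : 'M[R]_(r, m)).

(* Paths are taken continuous on all of [R]: outside [[a, b]] they are extended by
   composing with [clamp a b]. *)
Definition solves (z0 : 'cV[R]_r) A H B (z : R -> 'cV[R]_r) :=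
  mx_cont z /\ forall t, a <= t <= b ->
    z t = z0 + mx_integral a t (fun s => red_field A H B (z s) (u s)).

Lemma mx_integrable_field A H B (z : R -> 'cV[R]_r) : mx_cont z ->
  mx_integrable a b (fun s => A *m z s + contract2 H (z s) (z s) + B *m u s).
Proof.
move=> cz; apply: mx_integrableD; last exact: mx_integrableM (mx_cont_cst B) iu.
apply: mx_cont_integrable; apply: mx_contD; last exact: mx_cont_contract2.
exact: mx_contM (mx_cont_cst A) cz.
Qed.

Lemma solves_uniq z0 A H B z1 z2 : solves z0 A H B z1 -> solves z0 A H B z2 ->
  forall t, a <= t <= b -> z1 t = z2 t.
Proof.
move=> [c1 e1] [c2 e2].
pose w t := z1 t - z2 t.
have cw : mx_cont w.
  by move=> i j; under eq_fun do rewrite mxE [X in _ + X]mxE; exact: continuous_fB.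
have [M1 M10 hM1] := mx_cont_bounded ab c1.
have [M2 M20 hM2] := mx_cont_bounded ab c2.
(* A Lipschitz constant for the field between the two bounded solutions; the final 1 makes it
   positive, as [gronwall] asks. *)
pose L := r%:R * `|A| + r%:R * r%:R * `|H| * M1 + r%:R * r%:R * `|H| * M2 + 1.
have L0 : 0 < L by rewrite ltr_pwDr// !addr_ge0// !mulr_ge0.
have H1 t : a <= t <= b -> `|w t| <= 0 + L * sint a t (fun s => `|w s|).
  move=> tab; have /andP[a_t tb] := tab.
  rewrite add0r /w e1// e2// opprD addrACA subrr add0r -mx_integralB; first last.
  - exact: mx_integrableS (mx_integrable_field _ _ _ c2).
  - exact: mx_integrableS (mx_integrable_field _ _ _ c1).
  rewrite -sintZ; last by apply: continuous_sintegrable; exact: mx_cont_norm.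
  apply: mx_integral_norm_le.
  - apply: mx_integrableB.
      exact: mx_integrableS (mx_integrable_field _ _ _ c1).
    exact: mx_integrableS (mx_integrable_field _ _ _ c2).
  - by apply: sintegrableZ; apply: continuous_sintegrable; exact: mx_cont_norm.
  move=> s /andP[as_ st]; have sab : a <= s <= b by rewrite as_ (le_trans st).
  (* The quadratic terms are telescoped through the mixed value [contract2 H (z1 s) (z2 s)]. *)
  rewrite [X in `|X|](_ : _ = A *m w s + contract2 H (z1 s) (w s)
     + contract2 H (w s) (z2 s)); last first.
    rewrite /red_field !contractE /w.
    rewrite mulmxBr contract2Dr contract2Dl contract2Nl contract2Nr.
    move: (A *m z1 s) (A *m z2 s) (contract2 H (z1 s) (z1 s)) (contract2 H (z2 s) (z2 s))
      (contract2 H (z1 s) (z2 s)) (B *m u s) => b1 b2 b3 b4 b5 b6.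
    by apply/matrixP => i j; rewrite !mxE; ring.
  have h1 := mulmx_norm_le A (w s).
  have h2 := contract2_norm_le H (z1 s) (w s).
  have h3 := contract2_norm_le H (w s) (z2 s).
  have h2' : r%:R * r%:R * `|H| * `|z1 s| * `|w s| <= r%:R * r%:R * `|H| * M1 * `|w s|.
    by rewrite ler_wpM2r// ler_wpM2l ?hM1// !mulr_ge0.
  have h3' : r%:R * r%:R * `|H| * `|w s| * `|z2 s| <= r%:R * r%:R * `|H| * `|w s| * M2.
    by rewrite ler_wpM2l ?hM2// !mulr_ge0.
  have h4 := ler_normD (A *m w s + contract2 H (z1 s) (w s)) (contract2 H (w s) (z2 s)).
  have h5 := ler_normD (A *m w s) (contract2 H (z1 s) (w s)).
  rewrite /L; have := normr_ge0 (w s); lra.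
move=> t tab; apply/eqP; rewrite -subr_eq0 -normr_le0.
have := gronwall ab L0 (mx_cont_norm cw) _ H1 tab.
by rewrite mulr0 mul0r; apply => s _.
Qed.

(** This makes existence on the whole segment an open condition. Picard iteration solves the clipped
    equation for the difference [w]; Gronwall's bound then shows that the clipping was inactive. *)
Lemma solves_perturb z0 A H B z : solves z0 A H B z ->
  exists C delta, [/\ 0 <= C, 0 < delta & forall d dz0 dA dH dB,
    d <= delta -> `|dz0| <= d -> `|dA| <= d -> `|dH| <= d -> `|dB| <= d ->
    exists2 z', solves (z0 + dz0) (A + dA) (H + dH) (B + dB) z' &
      forall t, a <= t <= b -> `|z' t - z t| <= C * d].
Proof.
move=> [cz ez].
have [Z Z0 hZ] := mx_cont_bounded ab cz.
pose rr : R := r%:R * r%:R.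
have rr0 : 0 <= rr by rewrite mulr_ge0.
pose A1 := `|A| + 1; pose H1 := `|H| + 1.
have A10 : 0 <= A1 by rewrite addr_ge0.
have H10 : 0 <= H1 by rewrite addr_ge0.
(* Lipschitz constant of [G] below: [Z] comes from the two cross terms, the plain [2 * (rr * H1)]
   from the quadratic term in clipped arguments, and [A1], [H1] bound the perturbed coefficients for
   [d <= 1]. *)
pose L := r%:R * A1 + 2 * (rr * H1 * Z) + 2 * (rr * H1) + 1.
have L0 : 0 < L by rewrite ltr_pwDr// !addr_ge0// !mulr_ge0.
(* A majorant of the max norm of the input whose integrability is immediate. *)
pose nu s := \sum_(j < m) `|u s j 0|.
have inu : sintegrable a b nu.
  by apply: sintegrable_sum => j _; apply: sintegrable_abs; exact: iu.
have nu0 s : 0 <= nu s by exact: sumr_ge0.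
have unu s : `|u s| <= nu s.
  apply: mx_norm_le => // i j; rewrite ord1 /nu (bigD1 i)//= lerDl; exact: sumr_ge0.
(* Size of the forcing per unit of [d]: the initial value, then [dA z] and [dH : z z^T] over the
   length of the segment, then [dB u]. *)
pose kappa := 1 + (r%:R * Z + rr * Z * Z) * (b - a) + m%:R * sint a b nu.
have ba : 0 <= b - a by rewrite subr_ge0.
have inu0 : 0 <= sint a b nu by exact: sint_ge0.
have kappa0 : 0 <= kappa by rewrite !addr_ge0// !mulr_ge0// addr_ge0// !mulr_ge0.
pose C := 2 * kappa * expR (2 * L * (b - a)).
have C0 : 0 <= C by rewrite !mulr_ge0// expR_ge0.
(* The second bound gives [C * d <= 1], the range in which [clip] is the identity on [w]. *)
exists C, (Num.min 1 (C + 1)^-1); split => //.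
  by rewrite lt_min ltr01 invr_gt0; lra.
move=> d dz0 dA dH dB; rewrite le_min => /andP[d1 dC] hz0 hA hH hB.
have d0 : 0 <= d by apply: le_trans hA.
have hA' : `|A + dA| <= A1 by apply: le_trans (ler_normD _ _) _; rewrite lerD2l; lra.
have hH' : `|H + dH| <= H1 by apply: le_trans (ler_normD _ _) _; rewrite lerD2l; lra.
(* [picard] wants one Lipschitz constant for all real times, so [z] is held constant outside the
   segment. *)
pose zc t := z (clamp a b t).
have czc : mx_cont zc.
  move=> i j t; apply: (@continuous_comp _ _ _ (clamp a b) (fun s => z s i j)).
    exact: continuous_clamp.
  exact: cz.
have hzc t : `|zc t| <= Z by apply: hZ; exact: clamp_itv.
pose f1 s := dA *m z s + contract2 dH (z s) (z s) + dB *m u s.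
have if1 : mx_integrable a b f1 by exact: mx_integrable_field.
pose G s x := (A + dA) *m clip x + contract2 (H + dH) (zc s) (clip x)
  + contract2 (H + dH) (clip x) (zc s) + contract2 (H + dH) (clip x) (clip x).
have cG v : mx_cont v -> mx_cont (fun s => G s (v s)).
  move=> cv; have ccv := mx_cont_clip cv.
  by do 3! [apply: mx_contD; last exact: mx_cont_contract2];
    exact: mx_contM (mx_cont_cst _) ccv.
have lG s x y : `|G s x - G s y| <= L * `|x - y|.
  pose X := clip x; pose Y := clip y; pose W := X - Y.
  have -> : G s x - G s y = (A + dA) *m W + contract2 (H + dH) (zc s) W
    + contract2 (H + dH) W (zc s) + contract2 (H + dH) X W + contract2 (H + dH) W Y.
    rewrite /G -/X -/Y /W mulmxBr !contract2Dr !contract2Dl !contract2Nl !contract2Nr.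
    move: ((A + dA) *m X) ((A + dA) *m Y) (contract2 _ _ _) (contract2 _ _ _)
      (contract2 _ _ _) (contract2 _ _ _) (contract2 _ _ _) (contract2 _ _ _)
      (contract2 _ _ _) => b1 b2 b3 b4 b5 b6 b7 b8 b9.
    by apply/matrixP => i j; rewrite !mxE; ring.
  have W1 : `|W| <= `|x - y| by exact: clip_lipschitz.
  have key (p q : 'cV[R]_r) cp cq : `|p| <= cp -> `|q| <= cq ->
      `|contract2 (H + dH) p q| <= rr * H1 * (cp * cq).
    move=> hp hq; apply: le_trans (contract2_norm_le _ _ _) _.
    rewrite -mulrA; apply: ler_pM; rewrite ?mulr_ge0//.
      by rewrite ler_wpM2l.
    by apply: ler_pM.
  have h1 : `|(A + dA) *m W| <= r%:R * A1 * `|x - y|.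
    apply: le_trans (mulmx_norm_le _ _) _.
    by apply: ler_pM => //; rewrite ?mulr_ge0// ler_wpM2l.
  have h2 := key _ _ _ _ (hzc s) W1.
  have h3 := key _ _ _ _ W1 (hzc s).
  have h4 := key _ _ _ _ (clip_norm_le x) W1.
  have h5 := key _ _ _ _ W1 (clip_norm_le y).
  rewrite -/X -/Y in h4 h5.
  move: h1 h2 h3 h4 h5; set p1 := _ *m W; set p2 := contract2 _ (zc s) W.
  set p3 := contract2 _ W (zc s); set p4 := contract2 _ X W.
  set p5 := contract2 _ W Y => h1 h2 h3 h4 h5.
  have := ler_normD (p1 + p2 + p3 + p4) p5; have := ler_normD (p1 + p2 + p3) p4.
  have := ler_normD (p1 + p2) p3; have := ler_normD p1 p2.
  have := normr_ge0 (x - y); rewrite /L; lra.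
pose g t := dz0 + mx_integral a (clamp a b t) f1.
have cg : mx_cont g.
  by apply: mx_contD; [exact: mx_cont_cst|exact: mx_cont_integral_clamp].
have hg t : `|g t| <= kappa * d.
  apply: le_trans (ler_normD _ _) _.
  rewrite /kappa -addrA mulrDl mul1r lerD//.
  have /andP[h1 h2] := clamp_itv t ab.
  have iS f : sintegrable a b f -> sintegrable a (clamp a b t) f by exact: sintegrableS.
  pose k1 := (r%:R * Z + rr * Z * Z) * d.
  have k10 : 0 <= k1 by rewrite mulr_ge0// addr_ge0// !mulr_ge0.
  have i2 : sintegrable a b (fun s => k1 + m%:R * d * nu s).
    apply: sintegrableD; last exact: sintegrableZ.
    by apply: continuous_sintegrable; exact: continuous_fcst.
  apply: le_trans (mx_integral_norm_le (g := fun s => k1 + m%:R * d * nu s) _ _ _) _.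
  - exact: mx_integrableS if1.
  - exact: iS.
  - move=> s /andP[as_ st]; have sab : a <= s <= b by rewrite as_ (le_trans st).
    apply: le_trans (ler_normD _ _) _; rewrite lerD//.
      apply: le_trans (ler_normD _ _) _; rewrite /k1 mulrDl lerD//.
        apply: le_trans (mulmx_norm_le _ _) _; rewrite -!mulrA ler_wpM2l//.
        by rewrite [leRHS]mulrC ler_pM// hZ.
      apply: le_trans (contract2_norm_le _ _ _) _.
      rewrite -/rr [leRHS](_ : _ = rr * (d * (Z * Z))); last by ring.
      rewrite -!mulrA ler_wpM2l//; apply: ler_pM; rewrite ?mulr_ge0//.
      by apply: ler_pM => //; apply: ler_pM => //; exact: hZ.
    apply: le_trans (mulmx_norm_le _ _) _.
    by rewrite -!mulrA ler_wpM2l// ler_pM.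
  - rewrite sintD; [|by apply: continuous_sintegrable; exact: continuous_fcst
                    |by apply: iS; exact: sintegrableZ].
    rewrite sint_cst// sintZ; last exact: iS.
    have -> : ((r%:R * Z + rr * Z * Z) * (b - a) + m%:R * sint a b nu) * d
        = k1 * (b - a) + m%:R * d * sint a b nu by rewrite /k1; ring.
    rewrite lerD//; first by rewrite ler_wpM2l// lerD2r.
    rewrite ler_wpM2l ?mulr_ge0//.
    rewrite (@sint_cat _ a b (clamp a b t)) ?h1// lerDl; exact: sint_ge0.
have [w cw ew] := picard ab L0 cg cG lG.
have clip0 : clip 0 = 0 :> 'cV[R]_r by rewrite clip_id// normr0.
have G0 s : G s 0 = 0.
  have c0 h : contract2 (H + dH) h 0 = 0.
    by have := contract2Dr (H + dH) h 0 0; rewrite addr0 => /eqP;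
       rewrite -subr_eq0 opprD addrA subrr add0r oppr_eq0 => /eqP.
  have c0' h : contract2 (H + dH) 0 h = 0.
    by have := contract2Dl (H + dH) 0 0 h; rewrite addr0 => /eqP;
       rewrite -subr_eq0 opprD addrA subrr add0r oppr_eq0 => /eqP.
  by rewrite /G clip0 mulmx0 !c0 c0' !addr0.
have gr t : a <= t <= b -> `|w t| <= kappa * d + L * sint a t (fun s => `|w s|).
  move=> tab; rewrite ew//; apply: le_trans (ler_normD _ _) _; rewrite lerD//.
  rewrite -sintZ; last by apply: continuous_sintegrable; exact: mx_cont_norm.
  apply: mx_integral_norm_le.
  - by apply: mx_cont_integrable; exact: cG.
  - by apply: sintegrableZ; apply: continuous_sintegrable; exact: mx_cont_norm.
  - by move=> s _; have := lG s (w s) 0; rewrite G0 !subr0.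
have hw t : a <= t <= b -> `|w t| <= C * d.
  move=> tab; have := gronwall ab L0 (mx_cont_norm cw) _ gr tab.
  move=> /(_ (fun s _ => normr_ge0 _))/le_trans; apply.
  rewrite /C [leRHS](_ : _ = 2 * (kappa * d) * expR (2 * L * (b - a))); last by ring.
  apply: ler_wpM2l; first by rewrite !mulr_ge0.
  rewrite ler_expR; apply: ler_wpM2l; first by rewrite mulr_ge0// ltW.
  by rewrite lerD2r; case/andP: tab.
have hw1 t : a <= t <= b -> `|w t| <= 1.
  move=> /hw/le_trans; apply; have : C * d <= C * (C + 1)^-1 by rewrite ler_wpM2l.
  move=> /le_trans; apply; rewrite ler_pdivrMr; lra.
exists (fun t => z t + w t); last by move=> t /hw; rewrite addrAC subrr add0r.
split; first exact: mx_contD.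
move=> t tab; have /andP[a_t tb] := tab.
have iS (f : R -> 'cV[R]_r) : mx_integrable a b f -> mx_integrable a t f.
  exact: mx_integrableS.
rewrite (ez t)// (ew t)// /g clamp_id//.
rewrite [LHS](_ : _ = z0 + dz0 + (mx_integral a t (fun s => red_field A H B (z s) (u s))
  + mx_integral a t f1 + mx_integral a t (fun s => G s (w s)))); last first.
  move: (mx_integral _ _ _) (mx_integral _ _ _) (mx_integral _ _ _) => b1 b2 b3.
  by apply/matrixP => i j; rewrite !mxE; ring.
congr (_ + _); rewrite -mx_integralD; first last.
- exact: iS.
- by apply: iS; exact: (mx_integrable_field A H B cz).
rewrite -mx_integralD; first last.
- by apply: mx_cont_integrable; exact: cG.
- by apply: mx_integrableD; apply: iS => //; exact: (mx_integrable_field A H B cz).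
apply: mx_integral_eq => s /andP[as_ st].
have sab : a <= s <= b by rewrite as_ (le_trans st).
by rewrite red_field_perturb /G /zc clamp_id// clip_id// hw1.
Qed.

End Solutions.

(** * Differentials of matrix expressions *)

Section BoundedDiff.
Context {R : realType}.
Implicit Types (U V W : normedModType R).

(** An epsilon-delta criterion in which the candidate differential is a bare function. The linear
    bound makes it continuous, which uniqueness of the differential requires. *)
Lemma is_diff_bound V W (f : V -> W) x (L : V -> W) (k : R) :
  linear L -> (forall h, `|L h| <= k * `|h|) ->
  (forall e, 0 < e -> exists2 d, 0 < d &
     forall h, `|h| <= d -> `|f (x + h) - f x - L h| <= e * `|h|) ->
  is_diff x f L.
Proof.
move=> linL bL H.
pose L' : {linear V -> W} := HB.pack L (GRing.isLinear.Build _ _ _ _ L linL).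
have cL : continuous L'.
  move=> s; apply/cvgrPdist_le => e e0.
  have k0 : 0 < `|k| + 1 by rewrite ltr_pwDr.
  near=> t; rewrite -raddfB; apply: le_trans (bL _) _.
  apply: (@le_trans _ _ ((`|k| + 1) * `|s - t|)).
    by rewrite ler_wpM2r//; have := ler_norm k; lra.
  rewrite mulrC -ler_pdivlMr//; near: t.
  by have /cvgrPdist_le := @cvg_id _ (nbhs s); apply; rewrite divr_gt0.
have oL : f \o shift x = cst (f x) + L' +o_ 0 id.
  apply/eqaddoP => e e0; have [d d0 hd] := H _ e0.
  near=> h; rewrite /= [X in `|X|](_ : _ = f (x + h) - f x - L h).
    apply: hd; near: h; exact: nbhs0_le.
  by rewrite !fctE/= opprD addrA [h + x]addrC.
have E := diff_unique cL oL.
split => //; apply/diff_locallyP; rewrite E; split => //.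
Unshelve. all: by end_near. Qed.

Lemma is_diff_lin_bound V W (L : V -> W) (k : R) x :
  linear L -> (forall h, `|L h| <= k * `|h|) -> is_diff x L L.
Proof.
move=> linL bL; apply: (is_diff_bound linL bL) => e e0; exists 1 => // h _.
have -> : L (x + h) = L x + L h by have := linL 1 x h; rewrite !scale1r.
by rewrite addrAC addrK subrr normr0 mulr_ge0// ltW.
Qed.

Lemma fst_norm_le U V (p : U * V) : `|p.1| <= `|p|.
Proof. by rewrite [leRHS]/Num.norm/= le_max lexx. Qed.

Lemma snd_norm_le U V (p : U * V) : `|p.2| <= `|p|.
Proof. by rewrite [leRHS]/Num.norm/= le_max lexx orbT. Qed.

Lemma pair_norm_le U V (p : U * V) (c : R) : `|p.1| <= c -> `|p.2| <= c -> `|p| <= c.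
Proof. by move=> h1 h2; rewrite [leLHS]/Num.norm/= ge_max h1. Qed.

Lemma is_diff_fst U V (p : U * V) : is_diff p fst fst.
Proof. by apply: (@is_diff_lin_bound _ _ _ 1) => // h; rewrite mul1r fst_norm_le. Qed.

Lemma is_diff_snd U V (p : U * V) : is_diff p snd snd.
Proof. by apply: (@is_diff_lin_bound _ _ _ 1) => // h; rewrite mul1r snd_norm_le. Qed.

(** Common source of the product rules for [mulmx], [inner], [contract2] and [H_of]: the remainder
    of a bilinear map is exactly [beta h.1 h.2]. *)
Lemma is_diff_bilinear_bound (T : normedModType R) U V W (beta : U -> V -> W) (c : R)
    (f df : T -> U)
    (g dg : T -> V) x :
  (forall v, linear (beta^~ v)) -> (forall u, linear (beta u)) ->
  (forall u v, `|beta u v| <= c * `|u| * `|v|) ->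
  is_diff x f df -> is_diff x g dg ->
  is_diff x (fun t => beta (f t) (g t)) (fun h => beta (df h) (g x) + beta (f x) (dg h)).
Proof.
move=> linl linr bb fdf gdg.
have c'E : exists2 c', 0 <= c' & forall u v, `|beta u v| <= c' * `|u| * `|v|.
  exists `|c| => // u v; apply: le_trans (bb u v) _.
  by rewrite ler_wpM2r// ler_wpM2r// ler_norm.
have {bb c c'E} [c c0 bb] := c'E.
pose p := (f x, g x).
pose L (h : U * V) := beta h.1 p.2 + beta p.1 h.2.
have dL : is_diff p (fun q : U * V => beta q.1 q.2) L.
  apply: (@is_diff_bound _ _ _ _ _ (c * `|p.2| + c * `|p.1|)).
  - by move=> a h h'; rewrite /L/= linl linr scalerDr addrACA.
  - move=> h; apply: le_trans (ler_normD _ _) _; rewrite mulrDl lerD//.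
      apply: le_trans (bb _ _) _; rewrite mulrAC ler_wpM2l ?mulr_ge0//.
      exact: fst_norm_le.
    apply: le_trans (bb _ _) _; rewrite ler_wpM2l ?mulr_ge0//; exact: snd_norm_le.
  move=> e e0; exists (e / (c + 1)); first by rewrite divr_gt0//; lra.
  move=> h hd; rewrite /L/=.
  rewrite [X in `|X|](_ : _ = beta h.1 h.2); last first.
    have e1 v : beta (f x + h.1) v = beta (f x) v + beta h.1 v.
      by have := linl v 1 (f x) h.1; rewrite !scale1r.
    have e2 u : beta u (g x + h.2) = beta u (g x) + beta u h.2.
      by have := linr u 1 (g x) h.2; rewrite !scale1r.
    rewrite e1 !e2; move: (beta (f x) (g x)) (beta (f x) h.2) (beta h.1 (g x))
      (beta h.1 h.2) => b1 b2 b3 b4; apply/eqP; rewrite !subr_eq.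
    by rewrite [b4 + _]addrC [_ + b1]addrC !addrA [b1 + b3 + b2]addrAC.
  apply: le_trans (bb _ _) _.
  have h1 := fst_norm_le h; have h2 := snd_norm_le h.
  apply: (@le_trans _ _ (c * (e / (c + 1)) * `|h|)).
    by rewrite ler_pM ?mulr_ge0// ler_wpM2l// (le_trans h1).
  rewrite ler_wpM2r// mulrA ler_pdivrMr; last lra.
  by rewrite mulrC ler_wpM2l ?ltW//; lra.
exact: (is_diff_comp (is_diff_pair fdf gdg) dL).
Qed.

End BoundedDiff.

Section MatrixDiff.
Context {R : realType}.
Implicit Types (T : normedModType R).

Lemma is_diff_mulmx T m n p (f df : T -> 'M[R]_(m, n)) (g dg : T -> 'M[R]_(n, p)) x :
  is_diff x f df -> is_diff x g dg ->
  is_diff x (fun t => f t *m g t) (fun h => df h *m g x + f x *m dg h).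
Proof.
apply: (@is_diff_bilinear_bound _ _ _ _ _ mulmx n%:R).
- by move=> B a A A'; rewrite mulmxDl scalemxAl.
- by move=> A a B B'; rewrite mulmxDr scalemxAr.
- exact: mulmx_norm_le.
Qed.

Lemma is_diff_trmx T m n (f df : T -> 'M[R]_(m, n)) x :
  is_diff x f df -> is_diff x (fun t => (f t)^T) (fun h => (df h)^T).
Proof.
move=> fdf; apply: (is_diff_comp fdf).
apply: (@is_diff_lin_bound _ _ _ _ 1).
  by move=> a u v; rewrite linearP.
by move=> h; rewrite mul1r trmx_norm_le.
Qed.

Lemma inner_trace m n (X Y : 'M[R]_(m, n)) : inner X Y = \tr (X^T *m Y).
Proof.
rewrite /inner exchange_big/=; apply: eq_bigr => j _; rewrite mxE.
by apply: eq_bigr => i _; rewrite mxE.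
Qed.

Lemma innerDl m n (X X' Y : 'M[R]_(m, n)) : inner (X + X') Y = inner X Y + inner X' Y.
Proof. by rewrite !inner_trace linearD/= mulmxDl linearD. Qed.

Lemma innerDr m n (X Y Y' : 'M[R]_(m, n)) : inner X (Y + Y') = inner X Y + inner X Y'.
Proof. by rewrite !inner_trace mulmxDr linearD. Qed.

Lemma innerZl m n a (X Y : 'M[R]_(m, n)) : inner (a *: X) Y = a * inner X Y.
Proof. by rewrite !inner_trace linearZ/= -scalemxAl linearZ. Qed.

Lemma innerZr m n a (X Y : 'M[R]_(m, n)) : inner X (a *: Y) = a * inner X Y.
Proof. by rewrite !inner_trace -scalemxAr linearZ. Qed.

Lemma innerNl m n (X Y : 'M[R]_(m, n)) : inner (- X) Y = - inner X Y.
Proof. by rewrite -scaleN1r innerZl mulN1r. Qed.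

Lemma innerNr m n (X Y : 'M[R]_(m, n)) : inner X (- Y) = - inner X Y.
Proof. by rewrite -scaleN1r innerZr mulN1r. Qed.

Lemma innerC m n (X Y : 'M[R]_(m, n)) : inner X Y = inner Y X.
Proof. by apply: eq_bigr => i _; apply: eq_bigr => j _; rewrite mulrC. Qed.

Lemma inner0l m n (Y : 'M[R]_(m, n)) : inner 0 Y = 0.
Proof. by rewrite -(scale0r (0 : 'M[R]_(m, n))) innerZl mul0r. Qed.

Lemma inner_tr m n (X Y : 'M[R]_(m, n)) : inner X^T Y^T = inner X Y.
Proof.
rewrite /inner exchange_big/=.
by apply: eq_bigr => i _; apply: eq_bigr => j _; rewrite !mxE.
Qed.

Lemma inner_mulmxl m n p (A : 'M[R]_(m, n)) (X : 'M[R]_(n, p)) (Y : 'M[R]_(m, p)) :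
  inner Y (A *m X) = inner (A^T *m Y) X.
Proof. by rewrite !inner_trace trmx_mul trmxK mulmxA. Qed.

Lemma inner_mulmxr m n p (A : 'M[R]_(n, p)) (X : 'M[R]_(m, n)) (Y : 'M[R]_(m, p)) :
  inner Y (X *m A) = inner (Y *m A^T) X.
Proof.
by rewrite !inner_trace trmx_mul trmxK mulmxA mxtrace_mulC mulmxA.
Qed.

Lemma inner_sandwich m n p q (U : 'M[R]_(m, n)) (X : 'M[R]_(n, p)) (V : 'M[R]_(p, q)) Y :
  inner Y (U *m X *m V) = inner (U^T *m Y *m V^T) X.
Proof. by rewrite inner_mulmxr inner_mulmxl mulmxA. Qed.

Lemma inner_suml m n (I : Type) (s : seq I) (P : pred I) (F : I -> 'M[R]_(m, n)) Y :
  inner (\sum_(i <- s | P i) F i) Y = \sum_(i <- s | P i) inner (F i) Y.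
Proof.
elim/big_rec2: _ => [|i a b _ <-]; [exact: inner0l|exact: innerDl].
Qed.

Lemma inner_norm_le m n (X Y : 'M[R]_(m, n)) :
  `|inner X Y| <= m%:R * n%:R * `|X| * `|Y|.
Proof.
apply: le_trans (ler_norm_sum _ _ _) _.
have -> : m%:R * n%:R * `|X| * `|Y| = \sum_(i < m) \sum_(j < n) `|X| * `|Y|.
  by rewrite !sumr_const !card_ord -[RHS]mulr_natl -[X in _ = _ * X]mulr_natl !mulrA.
apply: ler_sum => i _; apply: le_trans (ler_norm_sum _ _ _) _.
by apply: ler_sum => j _; rewrite normrM ler_pM ?mx_entry_le.
Qed.

Lemma is_diff_inner T m n (f df g dg : T -> 'M[R]_(m, n)) x :
  is_diff x f df -> is_diff x g dg ->
  is_diff x (fun t => inner (f t) (g t) : R^o)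
    (fun h => inner (df h) (g x) + inner (f x) (dg h)).
Proof.
apply: (@is_diff_bilinear_bound _ _ _ _ R^o (@inner R m n) (m%:R * n%:R)).
- by move=> B a A A'; rewrite innerDl innerZl.
- by move=> A a B B'; rewrite innerDr innerZr.
- exact: inner_norm_le.
Qed.

Lemma enorm_sqr n (v : 'cV[R]_n) : enorm v ^+ 2 = inner v v.
Proof.
by rewrite /enorm sqr_sqrtr//; apply: sumr_ge0 => i _; apply: sumr_ge0 => j _;
  rewrite -expr2 sqr_ge0.
Qed.

Lemma mulmx3_norm_le n (A B C : 'M[R]_n) :
  `|A *m B *m C| <= n%:R * n%:R * `|A| * `|B| * `|C|.
Proof.
apply: le_trans (mulmx_norm_le _ _) _; rewrite ler_wpM2r//.
by rewrite -!mulrA ler_wpM2l// !mulrA mulmx_norm_le.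
Qed.

(** A row vector [v] killed by [X + h] satisfies [v = - v h X^-1], so smallness of [h] gives
    [|v| <= |v| / 2]. *)
Lemma unitmx_perturb n (X h : 'M[R]_n) : X \in unitmx ->
  2 * (n%:R * n%:R * `|invmx X| * `|h|) <= 1 -> X + h \in unitmx.
Proof.
move=> uX hh; rewrite -row_free_unit -kermx_eq0; apply: contraT.
move=> /rowV0Pn[v /sub_kermxP vk v0].
suff : `|v| <= 0 by rewrite normr_le0 (negPf v0).
have vE : v = - (v *m h *m invmx X).
  apply: (can_inj (mulmxK uX)); rewrite mulNmx mulmxKV//.
  by apply/eqP; rewrite -addr_eq0 -mulmxDr vk.
have : `|v| <= n%:R * (n%:R * `|v| * `|h|) * `|invmx X|.
  rewrite {1}vE normrN; apply: le_trans (mulmx_norm_le _ _) _.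
  by rewrite ler_wpM2r// ler_wpM2l// mulmx_norm_le.
have : `|v| * (2 * (n%:R * n%:R * `|invmx X| * `|h|)) <= `|v| * 1.
  by rewrite ler_wpM2l.
lra.
Qed.

(** Write [Y] and [Z] for the inverses of [X] and [X + h]. Using the resolvent identity
    [Z - Y = - Z h Y] twice gives the exact remainder [Z h Y h Y], which is quadratic in [h] once
    [|Z| <= 2 |Y|]. *)
Lemma is_diff_invmx n (X : 'M[R]_n) : X \in unitmx ->
  is_diff X invmx (fun h => - (invmx X *m h *m invmx X)).
Proof.
move=> uX; set Y := invmx X; set c : R := n%:R * n%:R.
have c0 : 0 <= c by rewrite mulr_ge0.
apply: (@is_diff_bound _ _ _ _ _ _ (c * `|Y| * `|Y|)).
- move=> a u v; rewrite mulmxDr mulmxDl opprD scalerN.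
  by rewrite -scalemxAr -scalemxAl.
- by move=> h; rewrite normrN [leRHS]mulrAC mulmx3_norm_le.
move=> e e0.
pose k := c * c * 2 * `|Y| * `|Y| * `|Y|.
have k0 : 0 <= k by rewrite !mulr_ge0.
(* The first radius keeps [X + h] invertible, the second turns [k |h|^2] into [e |h|]; the added 1s
   keep the denominators positive. *)
exists (Num.min (2 * (c * `|Y| + 1))^-1 (e / (k + 1))).
  by rewrite lt_min invr_gt0 divr_gt0// ?andbT; [rewrite mulr_gt0// ltr_pwDr// mulr_ge0|lra].
move=> h; rewrite le_min => /andP[h1 h2].
have small : 2 * (c * `|Y| * `|h|) <= 1.
  have : `|h| * (2 * (c * `|Y| + 1)) <= 1.
    by rewrite -ler_pdivlMr ?div1r// mulr_gt0// ltr_pwDr// mulr_ge0.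
  have := normr_ge0 h; lra.
have uXh := unitmx_perturb uX small.
set Z := invmx (X + h).
have E1 : Z - Y = - (Z *m h *m Y).
  have e1 : Z *m (X + h) = 1%:M by rewrite mulVmx.
  have : Z *m (X + h) *m Y = Y by rewrite e1 mul1mx.
  rewrite mulmxDr mulmxDl mulmxK// => H.
  by rewrite -{1}H opprD addrA subrr add0r.
have Zn : `|Z| <= 2 * `|Y|.
  have : `|Z| <= `|Y| + c * `|Z| * `|h| * `|Y|.
    have := mulmx3_norm_le Z h Y; have := ler_normB Y (Z *m h *m Y).
    by rewrite -E1 addrC subrK -/c; lra.
  have : `|Z| * (2 * (c * `|Y| * `|h|)) <= `|Z| * 1 by rewrite ler_wpM2l.
  lra.
have -> : Z - Y - - (Y *m h *m Y) = Z *m h *m Y *m h *m Y.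
  have -> : Z *m h *m Y = Y - Z by rewrite -[RHS]opprB E1 opprK.
  rewrite [in RHS]mulmxBl [in RHS]mulmxBl opprK addrC; congr (_ + _).
  by rewrite E1.
apply: le_trans (mulmx3_norm_le _ _ _) _; rewrite -/c.
have b1 := mulmx3_norm_le Z h Y; rewrite -/c in b1.
have b2 : c * `|Z *m h *m Y| * `|h| * `|Y| <= c * (c * (2 * `|Y|) * `|h| * `|Y|) * `|h| * `|Y|.
  rewrite ler_wpM2r// ler_wpM2r// ler_wpM2l//; apply: le_trans b1 _.
  by rewrite ler_wpM2r// ler_wpM2r// ler_wpM2l.
apply: le_trans b2 _.
rewrite [leLHS](_ : _ = k * `|h| * `|h|); last by rewrite /k; ring.
rewrite ler_wpM2r//; apply: (@le_trans _ _ (k * (e / (k + 1)))).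
  by rewrite ler_wpM2l.
rewrite mulrA ler_pdivrMr; last lra.
by rewrite mulrC ler_wpM2l ?(ltW e0)//; lra.
Qed.

(** Lets the entrywise [Jac] of the statement enter the chain rule: under differentiability the
    partial derivatives represent the differential. *)
Lemma Jac_mulmx n p (f : 'cV[R]_n -> 'cV[R]_p) x v : differentiable f x ->
  Jac f x *m v = 'd f x v.
Proof.
move=> df; apply/colP => j; rewrite mxE.
have dfj : is_diff x (fun x' => f x' j 0 : R^o) (fun h => 'd f x h j 0).
  apply: (@is_diff_comp _ _ _ _ f ('d f x) (fun M : 'cV[R]_p => M j 0 : R^o)
    (fun M : 'cV[R]_p => M j 0)).
    by split.
  apply: (@is_diff_lin_bound _ _ R^o _ 1).
    by move=> a A A'; rewrite !mxE.
  by move=> h; rewrite mul1r mx_entry_le.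
rewrite [in RHS](matrix_sum_delta v) linear_sum summxE; apply: eq_bigr => k _.
rewrite big_ord1 linearZ !mxE mulrC; congr (_ * _).
by rewrite deriveE ?diff_val.
Qed.

End MatrixDiff.

(** * The adjoint identity *)

Section Adjoint.
Context {R : realType}.

Lemma is_diff_ext (V W : normedModType R) (f g df dg : V -> W) x :
  is_diff x f df -> f =1 g -> df =1 dg -> is_diff x g dg.
Proof. by move=> h /funext <- /funext <-. Qed.

Lemma is_diff_contract2 r (H : tensor R r) (z : 'cV[R]_r) :
  is_diff z (fun x => contract2 H x x) (fun x => contract2 H x z + contract2 H z x).
Proof.
have linl v : linear ((@contract2 R r H)^~ v).
  move=> k x y; rewrite contract2Dl; congr (_ + _).
  apply/colP => i; rewrite !mxE mulr_sumr; apply: eq_bigr => p _.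
  by rewrite mulr_sumr; apply: eq_bigr => q _; rewrite mxE; ring.
have linr v : linear (contract2 H v).
  move=> k x y; rewrite contract2Dr; congr (_ + _).
  apply/colP => i; rewrite !mxE mulr_sumr; apply: eq_bigr => p _.
  by rewrite mulr_sumr; apply: eq_bigr => q _; rewrite mxE; ring.
exact: (is_diff_bilinear_bound linl linr (contract2_norm_le H)
  (is_diff_id z) (is_diff_id z)).
Qed.

Lemma is_diff_red_field r m (A : 'M[R]_r) (H : tensor R r) (B : 'M[R]_(r, m)) u z :
  is_diff z (fun z' => red_field A H B z' u)
    (fun x => A *m x + contract2 H x z + contract2 H z x).
Proof.
have dA : is_diff z (fun z' : 'cV[R]_r => A *m z') (fun x => A *m x).
  apply: (is_diff_ext (is_diff_mulmx (is_diff_cst A z) (is_diff_id z))) => // x.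
  by rewrite mul0mx add0r.
apply: (is_diff_ext (is_diffD (is_diffD dA (is_diff_contract2 H z))
  (is_diff_cst (B *m u) z))) => // x.
by rewrite !fctE addr0 addrA.
Qed.

Lemma Jac_red_field r m (A : 'M[R]_r) (H : tensor R r) (B : 'M[R]_(r, m)) u z x :
  Jac (fun z' => red_field A H B z' u) z *m x =
  A *m x + contract2 H x z + contract2 H z x.
Proof.
have h := is_diff_red_field A H B u z.
by rewrite Jac_mulmx ?diff_val.
Qed.

(** By [Jac_red_field] the Jacobian does not involve the value of the input, so it is continuous in
    time although [u] is not. Hence the adjoint has a continuous derivative, as integration by parts
    requires of one factor. *)
Lemma mx_cont_Jac_red_field r m (A : 'M[R]_r) (H : tensor R r) (B : 'M[R]_(r, m))
    (u : R -> 'cV[R]_m) (z : R -> 'cV[R]_r) : mx_cont z ->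
  mx_cont (fun s => Jac (fun z' => red_field A H B z' (u s)) (z s)).
Proof.
move=> cz i j.
have -> : (fun s => Jac (fun z' => red_field A H B z' (u s)) (z s) i j) =
    (fun s => (A *m delta_mx j 0 + contract2 H (delta_mx j 0) (z s)
               + contract2 H (z s) (delta_mx j 0)) i (0 : 'I_1)).
  by apply/funext => s; rewrite -(Jac_red_field A H B (u s)) -colE [RHS]mxE.
suff : mx_cont (fun s => A *m delta_mx j (0 : 'I_1)
    + contract2 H (delta_mx j 0) (z s) + contract2 H (z s) (delta_mx j 0)) by apply.
have cd : mx_cont (fun=> delta_mx j 0 : 'cV[R]_r) by exact: (mx_cont_cst _).
by do 2! [apply: mx_contD; last exact: mx_cont_contract2]; exact: (mx_cont_cst _).
Qed.

Lemma inner_colE r (x y : 'cV[R]_r) : inner x y = \sum_i x i 0 * y i 0.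
Proof. by apply: eq_bigr => i _; rewrite big_ord1. Qed.

Lemma mx_cont_sintegrable_inner r a b (f g : R -> 'cV[R]_r) :
  mx_cont f -> mx_integrable a b g -> sintegrable a b (fun s => inner (f s) (g s)).
Proof.
move=> cf ig; apply: (@sintegrable_eq _ _ _ (fun s => \sum_i f s i 0 * g s i 0)).
  by move=> s _; rewrite inner_colE.
by apply: sintegrable_sum => i _; exact: sintegrableM.
Qed.

Lemma inner_by_parts r a b (l dl F phi : R -> 'cV[R]_r) : a <= b ->
  mx_cont l -> mx_cont dl -> mx_cont F -> mx_integrable a b phi ->
  (forall s t, a <= s -> s <= t -> t <= b -> l t - l s = mx_integral s t dl) ->
  (forall s t, a <= s -> s <= t -> t <= b -> F t - F s = mx_integral s t phi) ->
  inner (l b) (F b) - inner (l a) (F a) =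
  sint a b (fun s => inner (dl s) (F s) + inner (l s) (phi s)).
Proof.
move=> ab cl cdl cF ip hl hF.
rewrite !inner_colE -sumrB.
rewrite (@sint_eq _ a b _ (fun s => \sum_i (dl s i 0 * F s i 0 + l s i 0 * phi s i 0))); last first.
  by move=> s _; rewrite !inner_colE big_split.
rewrite sint_sum; last first.
  move=> i _; apply: sintegrableD; apply: sintegrableM => //.
  exact: continuous_sintegrable.
apply: eq_bigr => i _.
apply: (sint_by_parts (l := fun s => l s i 0) (F := fun s => F s i 0)) => //.
- move=> s t as_ st tb; have := hl s t as_ st tb => /matrixP/(_ i 0).
  by rewrite mx_integralE => <-; rewrite !mxE.
- move=> s t as_ st tb; have := hF s t as_ st tb => /matrixP/(_ i 0).
  by rewrite mx_integralE => <-; rewrite !mxE.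
Qed.

Section Expansion.
Context {r m : nat}.
Variables (a b c : R) (u : R -> 'cV[R]_m).
Hypotheses (ab : a <= b) (iu : mx_integrable a b u) (acb : a <= c <= b).
Variables (z0 : 'cV[R]_r) (A : 'M[R]_r) (H : tensor R r) (B : 'M[R]_(r, m)).
Variables (z lam : R -> 'cV[R]_r).
Hypothesis zsol : solves a b u z0 A H B z.
Let J s := Jac (fun z' => red_field A H B z' (u s)) (z s).
Hypothesis clam : mx_cont lam.
Hypothesis lam_eq : forall s t, a <= s -> s <= t -> t <= c ->
  lam t - lam s = mx_integral s t (fun s' => - ((J s')^T *m lam s')).

(* The first variation of the state is never computed: pairing the difference
   of two trajectories with the adjoint cancels its linear part. *)
Lemma adjoint_expansion (C : R) : 0 <= C ->
  exists2 k, 0 <= k & forall d dz0 dA dH dB z',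
    d <= 1 -> `|dA| <= d -> `|dH| <= d -> `|dB| <= d ->
    solves a b u (z0 + dz0) (A + dA) (H + dH) (B + dB) z' ->
    (forall t, a <= t <= b -> `|z' t - z t| <= C * d) ->
    `|inner (lam c) (z' c - z c) - (inner (lam a) dz0
       + sint a c (fun s => inner (lam s)
           (dA *m z s + contract2 dH (z s) (z s) + dB *m u s)))| <= k * d ^+ 2.
Proof.
move=> C0; have [cz ez] := zsol; have /andP[ac cb] := acb.
have [Z Z0 hZ] := mx_cont_bounded ab cz.
have [La La0 hLa] := mx_cont_bounded ab clam.
pose rr : R := r%:R * r%:R.
have rr0 : 0 <= rr by rewrite mulr_ge0.
(* Coefficient of [d ^+ 2] in the bound on [rho] below: from [dA w], from the two terms pairing [dH]
   with [z] and [w], and from the term quadratic in [w]. *)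
pose k1 := r%:R * C + 2 * (rr * Z * C) + rr * (`|H| + 1) * C * C.
have k10 : 0 <= k1 by rewrite !addr_ge0// !mulr_ge0// addr_ge0.
exists (r%:R * La * k1 * (c - a)).
  by rewrite !mulr_ge0// subr_ge0.
move=> d dz0 dA dH dB z' d1 hA hH hB [cz' ez'] hw.
have d0 : 0 <= d by apply: le_trans hA.
pose w s := z' s - z s.
have cw : mx_cont w.
  by move=> i j; under eq_fun do rewrite mxE [X in _ + X]mxE; exact: continuous_fB.
pose f1 s := dA *m z s + contract2 dH (z s) (z s) + dB *m u s.
have if1 : mx_integrable a b f1 by exact: mx_integrable_field.
pose g1 s := (A + dA) *m w s + contract2 (H + dH) (z s) (w s)
  + contract2 (H + dH) (w s) (z s) + contract2 (H + dH) (w s) (w s).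
have cg1 : mx_cont g1.
  by do 3! [apply: mx_contD; last exact: mx_cont_contract2];
    exact: mx_contM (mx_cont_cst _) cw.
(* What remains of [g1] after removing its linearization [J s *m w s] at the base parameters. *)
pose rho s := dA *m w s + contract2 dH (z s) (w s) + contract2 dH (w s) (z s)
  + contract2 (H + dH) (w s) (w s).
have crho : mx_cont rho.
  by do 3! [apply: mx_contD; last exact: mx_cont_contract2];
    exact: mx_contM (mx_cont_cst _) cw.
pose phi s := f1 s + g1 s.
have iphi : mx_integrable a b phi.
  by apply: mx_integrableD => //; exact: mx_cont_integrable.
have JE s x : J s *m x = A *m x + contract2 H x (z s) + contract2 H (z s) x.
  exact: Jac_red_field.
have g1E s : g1 s = J s *m w s + rho s.
  rewrite JE /g1 /rho !contract2DT mulmxDl.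
  move: (A *m w s) (dA *m w s) (contract2 H (z s) (w s)) (contract2 H (w s) (z s))
    (contract2 dH (z s) (w s)) (contract2 dH (w s) (z s)) (contract2 H (w s) (w s))
    (contract2 dH (w s) (w s)) => b1 b2 b3 b4 b5 b6 b7 b8.
  by apply/matrixP => i j; rewrite !mxE; ring.
have fieldE s : red_field (A + dA) (H + dH) (B + dB) (z' s) (u s) =
    red_field A H B (z s) (u s) + phi s.
  have -> : z' s = z s + w s by rewrite /w addrC subrK.
  by rewrite red_field_perturb -addrA.
have wE t : a <= t <= b -> w t = dz0 + mx_integral a t phi.
  move=> tab; have /andP[a_t tb] := tab; rewrite /w ez'// ez//.
  rewrite (mx_integral_eq (fun s _ => fieldE s)) mx_integralD; first last.
  - exact: mx_integrableS iphi.
  - exact: mx_integrableS (mx_integrable_field iu A H B cz).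
  move: (mx_integral _ _ _) (mx_integral _ _ _) => b1 b2.
  by apply/matrixP => i j; rewrite !mxE; ring.
have wa : w a = dz0 by rewrite wE ?lexx// mx_integral_pt addr0.
have hF s t : a <= s -> s <= t -> t <= c -> w t - w s = mx_integral s t phi.
  move=> as_ st tc; have tb := le_trans tc cb.
  rewrite (wE t) ?(le_trans as_)// (wE s) ?as_ ?(le_trans st)//.
  rewrite (@mx_integral_cat _ _ _ a t s) ?as_//; last exact: mx_integrableS iphi.
  by rewrite opprD addrACA subrr add0r addrAC subrr add0r.
pose dl s := - ((J s)^T *m lam s).
have cJ : mx_cont J by exact: mx_cont_Jac_red_field.
have cdl : mx_cont dl.
  have cJl : mx_cont (fun s => (J s)^T *m lam s) by exact: mx_contM (mx_cont_tr cJ) clam.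
  move=> i j.
  have -> : (fun s => dl s i j) = (fun s => 0 - ((J s)^T *m lam s) i j).
    by apply/funext => s; rewrite /dl mxE sub0r.
  exact: (continuous_fB (fun=> 0) _ (continuous_fcst 0) (cJl i j)).
have := inner_by_parts ac clam cdl cw (mx_integrableS (lexx a) cb iphi) lam_eq hF.
rewrite wa => /eqP; rewrite subr_eq => /eqP; rewrite -/(w c) => ->.
have iS (f : R -> R) : sintegrable a b f -> sintegrable a c f by exact: sintegrableS.
have i1 : sintegrable a c (fun s => inner (lam s) (f1 s)).
  by apply: iS; exact: mx_cont_sintegrable_inner.
have i2 : sintegrable a c (fun s => inner (lam s) (rho s)).
  by apply: mx_cont_sintegrable_inner => //; exact: mx_cont_integrable.
rewrite (@sint_eq _ a c _ (fun s => inner (lam s) (f1 s) + inner (lam s) (rho s))); last first.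
  move=> s _; rewrite /phi g1E (innerDr _ (f1 s)) (innerDr _ (J s *m w s)) /dl innerNl.
  by rewrite (inner_mulmxl (J s)); ring.
rewrite sintD//.
rewrite [X in `|X|](_ : _ = sint a c (fun s => inner (lam s) (rho s))); last first.
  move: (sint a c (fun s => inner (lam s) (rho s))) => S2.
  rewrite -/(sint a c (fun s => inner (lam s) (f1 s))).
  by move: (sint a c _) (inner _ _) => S1 S0; ring.
have hrho s : a <= s <= b -> `|rho s| <= k1 * d ^+ 2.
  move=> sab.
  have ws := hw s sab; rewrite -/(w s) in ws.
  have dd : d * d <= d by rewrite ler_piMr.
  have h1 : `|dA *m w s| <= r%:R * (d * (C * d)).
    apply: le_trans (mulmx_norm_le _ _) _.
    by rewrite -mulrA ler_wpM2l// ler_pM.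
  have h2 : `|contract2 dH (z s) (w s)| <= rr * (d * (Z * (C * d))).
    apply: le_trans (contract2_norm_le _ _ _) _.
    rewrite [leLHS](_ : _ = rr * (`|dH| * (`|z s| * `|w s|))); last by rewrite /rr; ring.
    rewrite ler_wpM2l//; apply: ler_pM; rewrite ?mulr_ge0//.
    by apply: ler_pM => //; exact: hZ.
  have h3 : `|contract2 dH (w s) (z s)| <= rr * (d * ((C * d) * Z)).
    apply: le_trans (contract2_norm_le _ _ _) _.
    rewrite [leLHS](_ : _ = rr * (`|dH| * (`|w s| * `|z s|))); last by rewrite /rr; ring.
    rewrite ler_wpM2l//; apply: ler_pM; rewrite ?mulr_ge0//.
    by apply: ler_pM => //; exact: hZ.
  have h4 : `|contract2 (H + dH) (w s) (w s)| <= rr * ((`|H| + 1) * ((C * d) * (C * d))).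
    apply: le_trans (contract2_norm_le _ _ _) _.
    rewrite [leLHS](_ : _ = rr * (`|H + dH| * (`|w s| * `|w s|))); last by rewrite /rr; ring.
    rewrite ler_wpM2l//; apply: ler_pM; rewrite ?mulr_ge0//.
      by apply: le_trans (ler_normD _ _) _; rewrite lerD2l; lra.
    by rewrite ler_pM.
  move: h1 h2 h3 h4; rewrite /rho; set p1 := dA *m _; set p2 := contract2 _ (z s) _.
  set p3 := contract2 _ _ (z s); set p4 := contract2 (H + dH) _ _ => h1 h2 h3 h4.
  have := ler_normD (p1 + p2 + p3) p4; have := ler_normD (p1 + p2) p3.
  have := ler_normD p1 p2; rewrite /k1 expr2; lra.
apply: le_trans (sint_abs_le (g := fun=> r%:R * La * k1 * d ^+ 2) _ _ _) _ => //.
- by apply: continuous_sintegrable; exact: continuous_fcst.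
- move=> s /andP[as_ sc]; have sab : a <= s <= b by rewrite as_ (le_trans sc).
  apply: le_trans (inner_norm_le _ _) _.
  rewrite mulr1 -!mulrA ler_wpM2l//; apply: ler_pM => //; first exact: hLa.
  exact: hrho.
- by rewrite sint_cst// le_eqVlt; apply/orP; left; apply/eqP; ring.
Qed.

End Expansion.
End Adjoint.
Arguments mx_cont_Jac_red_field {R r m} A H B u z cz i j x : rename.

(** * The squared output error as a function of both bases and the reduced state *)

Section OutputCost.
Context {R : realType}.

(** The state [zeta] varies independently here; its dependence on the parameters is brought in later
    by the adjoint expansion. *)
Lemma is_diff_out_cost n r p (y : 'cV[R]_p) (h : 'cV[R]_n -> 'cV[R]_p)
    (Phi Psi : 'M[R]_(n, r)) (zeta : 'cV[R]_r) :
  Psi^T *m Phi \in unitmx -> differentiable h (lift_state Phi Psi zeta) ->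
  let e := y - h (lift_state Phi Psi zeta) in
  let C := Jac h (lift_state Phi Psi zeta) in
  let M := invmx (Psi^T *m Phi) in
  is_diff (Phi, Psi, zeta)
    (fun q : 'M[R]_(n, r) * 'M[R]_(n, r) * 'cV[R]_r =>
       enorm (y - h (lift_state q.1.1 q.1.2 q.2)) ^+ 2 : R^o)
    (fun v => inner (- (2 *: ((1%:M - Psi *m M^T *m Phi^T) *m C^T *m e *m zeta^T *m M^T))) v.1.1
       + inner (2 *: (Phi *m M *m zeta *m e^T *m C *m Phi *m M)) v.1.2
       - inner (2 *: (M^T *m Phi^T *m C^T *m e)) v.2).
Proof.
move=> uM dh e C M.
set q0 := (Phi, Psi, zeta).
have d1 : is_diff q0 (fun q => q.1.1) (fun v => v.1.1).
  exact: (is_diff_comp (is_diff_fst q0) (is_diff_fst q0.1)).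
have d2 : is_diff q0 (fun q => q.1.2) (fun v => v.1.2).
  exact: (is_diff_comp (is_diff_fst q0) (is_diff_snd q0.1)).
have d3 : is_diff q0 (fun q => q.2) (fun v => v.2) by exact: is_diff_snd.
have dG := is_diff_mulmx (is_diff_trmx d2) d1.
have dI := is_diff_comp dG (is_diff_invmx (uM : q0.1.2^T *m q0.1.1 \in unitmx)).
have dl := is_diff_mulmx (is_diff_mulmx d1 dI) d3.
have dhl : is_diff (lift_state Phi Psi zeta) h ('d h (lift_state Phi Psi zeta)) by [].
have dc := is_diff_comp dl dhl.
have de := is_diffB (is_diff_cst y q0) dc.
apply: (is_diff_ext (is_diff_inner de de)) => [q|v]; first by rewrite enorm_sqr.
rewrite /= !fctE /= sub0r innerC -mulr2n innerNr.
rewrite -/e -Jac_mulmx// -/C -/M.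
move: e C M => e C M; case: v => -[v1 v2] v3 /=.
rewrite !(mulNmx, mulmxN, mulmxDr, mulmxDl) !innerDr !innerNr !innerDr.
rewrite !mulmxA.
(* [t1] and [t3] stem from [Phi] outside and inside the inverse and combine into
   [I - Psi M^T Phi^T]; [t2] stems from [Psi] and [t4] from the state. *)
have t1 : inner e (C *m v1 *m M *m zeta) = inner (C^T *m e *m zeta^T *m M^T) v1.
  by rewrite -(mulmxA (C *m v1)) inner_sandwich trmx_mul !mulmxA.
have t2 : inner e (C *m Phi *m M *m v2^T *m Phi *m M *m zeta) =
    inner (Phi *m M *m zeta *m e^T *m C *m Phi *m M) v2.
  rewrite -(mulmxA _ M zeta) -(mulmxA (C *m Phi *m M *m v2^T) Phi) inner_sandwich -[RHS]inner_tr.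
  by rewrite !trmx_mul !trmxK !mulmxA.
have t3 : inner e (C *m Phi *m M *m Psi^T *m v1 *m M *m zeta) =
    inner (Psi *m M^T *m Phi^T *m C^T *m e *m zeta^T *m M^T) v1.
  by rewrite -(mulmxA _ M zeta) inner_sandwich !trmx_mul !trmxK !mulmxA.
have t4 : inner e (C *m Phi *m M *m v3) = inner (M^T *m Phi^T *m C^T *m e) v3.
  by rewrite inner_mulmxl !trmx_mul !mulmxA.
rewrite t1 t2 t3 t4 mul1mx innerNl !innerZl innerDl innerNl; ring.
Qed.

End OutputCost.

(** * The Lagrangian along trajectories *)

Section Trajectory.
Context {R : realType} {n m p r : nat}.
Variable D : rom_data R n m p.
Hypothesis D_ok : rom_data_ok D.
Notation mu := (@lebesgue_measure R).
Notation a := (tstart D).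
Notation b := (tend D).
Notation u := (input D).
Implicit Types (Psi : 'M[R]_(n, r)) (A : 'M[R]_r) (H : tensor R r) (B : 'M[R]_(r, m)).

Lemma time_itv i : (i < nsamp D)%N -> a <= time D i <= b.
Proof.
have [N0 tS _ _] := D_ok.
have mono k j : (j + k < nsamp D)%N -> time D j <= time D (j + k).
  elim: k => [|k IH]; rewrite ?addn0// addnS => h.
  by apply: le_trans (IH (ltnW h)) (tS _ h).
move=> iN; rewrite /tstart /tend (mono i 0%N)//=.
have := mono ((nsamp D).-1 - i)%N i; rewrite subnKC; first by apply; rewrite prednK.
by rewrite -ltnS prednK.
Qed.

Lemma tstart_le_tend : a <= b.
Proof.
have [N0 _ _ _] := D_ok.
by have /andP[] : a <= time D (nsamp D).-1 <= b by apply: time_itv; rewrite prednK.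
Qed.

Lemma input_integrable : mx_integrable a b u.
Proof. by have [_ _ iu _] := D_ok; move=> j i; rewrite ord1; exact: iu. Qed.

Lemma is_trajectory_solves Psi A H B z : is_trajectory D Psi A H B z ->
  solves a b u (Psi^T *m state0 D) A H B (z \o clamp a b).
Proof.
move=> [cz z0 ez]; split.
  apply: continuous_mx_cont.
  exact: within_continuous_clamp tstart_le_tend cz.
move=> t tab; have /andP[a_t tb] := tab.
have -> : (z \o clamp a b) t = z t by rewrite /comp clamp_id.
have tab' : t \in `[a, b] by rewrite in_itv.
rewrite (ez t tab') z0; congr (_ + _).
apply: mx_integral_eq => s /andP[as_ st].
by rewrite /comp clamp_id// as_ (le_trans st).
Qed.

Lemma solves_is_trajectory Psi A H B z :
  solves a b u (Psi^T *m state0 D) A H B z -> is_trajectory D Psi A H B z.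
Proof.
move=> [cz ez].
have za : z a = Psi^T *m state0 D.
  by rewrite ez ?lexx ?tstart_le_tend// mx_integral_pt addr0.
split => //; first by apply: continuous_subspaceT; exact: mx_cont_continuous.
by move=> s; rewrite in_itv/= => sab; rewrite za ez.
Qed.

Lemma trajectory_is Psi A H B z :
  solves a b u (Psi^T *m state0 D) A H B z ->
  is_trajectory D Psi A H B (trajectory D Psi A H B).
Proof.
move=> /solves_is_trajectory zt.
exact: (@xgetPex _ (fun=> 0) [set z | is_trajectory D Psi A H B z]) (ex_intro _ z zt).
Qed.

(** Uniqueness pins down the choice made by [xget], but only on the segment. *)
Lemma trajectoryE Psi A H B z :
  solves a b u (Psi^T *m state0 D) A H B z ->
  forall t, a <= t <= b -> trajectory D Psi A H B t = z t.
Proof.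
move=> zs t tab; have /is_trajectory_solves ts := trajectory_is zs.
by rewrite -(solves_uniq tstart_le_tend input_integrable ts zs tab)/= clamp_id.
Qed.

(** Lebesgue differentiation is applied to each coordinate of the integrated equation; finitely many
    exceptional null sets are then united. *)
Lemma ae_trajectory_derive1 Psi A H B y : is_trajectory D Psi A H B y ->
  {ae mu, forall s, a < s < b -> derive1 y s = red_field A H B (y s) (u s)}.
Proof.
move=> yt; have [cy ey] := is_trajectory_solves yt.
set yc := y \o clamp a b in cy ey.
pose F s := red_field A H B (yc s) (u s).
have iF : mx_integrable a b F by exact: (mx_integrable_field input_integrable A H B cy).
have : {ae mu, forall s, forall i : 'I_r, a < s < b ->
    derivable (fun t => sint a t (fun s => F s i 0)) s 1 /\
    derive1 (fun t => sint a t (fun s => F s i 0)) s = F s i 0}.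
  have ff := ae_filter_ringOfSetsType mu.
  apply: filter_forall => i; exact: ae_derivable_sint (iF i 0).
apply: filterS; first exact: (ae_filter_ringOfSetsType mu).
move=> s hs sab; have /andP[as_ sb] := sab.
have E i : {near s, (fun t => yc a i 0 + sint a t (fun s => F s i 0)) =1
                     (fun t => y t i 0)}.
  near=> t.
  have tab : a <= t <= b.
    by apply/andP; split; apply/ltW; near: t; [exact: lt_nbhsr|exact: lt_nbhsl].
  have aab : a <= a <= b by rewrite lexx tstart_le_tend.
  have -> : y t = yc t by rewrite /yc/= clamp_id.
  by rewrite (ey t)// (ey a)// mx_integral_pt addr0 [in RHS]mxE mx_integralE.
have dy i : derivable (fun t => y t i 0) s 1 /\ 'D_1 (fun t => y t i 0) s = F s i 0.
  have [d1 d2] := hs i sab.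
  have d3 : derivable (fun t => yc a i 0 + sint a t (fun s => F s i 0)) s 1.
    by apply: derivableD.
  split; first exact: (@near_eq_derivable _ _ _ _ _ _ _ (E i) d3).
  rewrite -(near_eq_derive _ (E i)) deriveD// derive_cst add0r -derive1E.
  exact: d2.
have dY : derivable y s 1.
  by apply/derivable_mxP => i j; rewrite ord1; case: (dy i).
rewrite derive1E derive_mx//; apply/colP => i; rewrite mxE.
by case: (dy i) => _ ->; rewrite /F /yc/= clamp_id// !ltW.
Unshelve. all: by end_near. Qed.

(** The integrand of the multiplier term vanishes only almost everywhere and is not known to be
    measurable, which is why [integral_ae0] is used. *)
Lemma lagrangian_AHE lam Phi Psi A H B z :
  solves a b u (Psi^T *m state0 D) A H B z ->
  lagrangian_AH D lam Phi Psi A H B =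
  \sum_(i < nsamp D) enorm (out_err D Phi Psi z i) ^+ 2.
Proof.
move=> zs; have yt := trajectory_is zs.
rewrite /lagrangian_AH; apply: eq_bigr => i _.
have tab := time_itv (ltn_ord i).
have [_ ya _] := yt.
have -> : out_err D Phi Psi (trajectory D Psi A H B) i = out_err D Phi Psi z i.
  by rewrite /out_err (trajectoryE zs tab).
rewrite ya subrr innerC inner0l addr0 -[RHS]addr0; congr (_ + _).
apply: integral_ae0 => //.
(* The differential equation is available inside the open interval only, so both end points are
   discarded as null sets. *)
have neq (c : R) : {ae mu, forall s, s != c}.
  exists [set c]; split => //; first exact: lebesgue_measure_set1.
  by move=> s /= /negP; rewrite negbK => /eqP.
have ff := ae_filter_ringOfSetsType mu.
apply: filterS3 (neq a) (neq b) (ae_trajectory_derive1 yt) => s sa sb hs.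
rewrite /= in_itv/= => /andP[as_ st].
rewrite hs ?subrr 1?innerC ?inner0l// lt_neqAle eq_sym sa as_ lt_neqAle sb/=.
by case/andP: tab => _; exact: le_trans.
Qed.

End Trajectory.

(** * Locality and sums of differentials *)

Section DiffLocal.
Context {R : realType}.

Lemma is_diff_eps (V W : normedModType R) (f L : V -> W) x : is_diff x f L ->
  forall e, 0 < e -> exists2 d, 0 < d &
    forall h, `|h| <= d -> `|f (x + h) - f x - L h| <= e * `|h|.
Proof.
move=> fL e e0.
have /diff_locally/eqaddoP/(_ _ e0) : differentiable f x by [].
rewrite (@diff_val _ _ _ _ _ _ _ fL).
move=> /nbhs_norm0P[d /= d0 hd].
exists (d / 2); first by rewrite divr_gt0.
move=> h hd2; have /hd : `|h| < d by lra.
by rewrite /= !fctE/= opprD addrA [h + x]addrC.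
Qed.

Lemma is_diff_linear (V W : normedModType R) (f L : V -> W) x : is_diff x f L ->
  linear L /\ exists k, forall h, `|L h| <= k * `|h|.
Proof.
move=> fL.
have E : 'd f x = L :> (V -> W) by exact: diff_val.
rewrite -E; split; first exact: linearP.
have cd : continuous ('d f x) by apply: diff_continuous.
have [k _ hk] := linear_lipschitz cd.
by exists k.
Qed.

(** Needed because the Lagrangian is identified with the sum of squared errors only where a
    trajectory is known to exist, near the base point. The base point itself is the case [h = 0]. *)
Lemma is_diff_local (V W : normedModType R) (f g L : V -> W) x (d : R) :
  is_diff x f L -> 0 < d -> (forall h, `|h| <= d -> f (x + h) = g (x + h)) ->
  is_diff x g L.
Proof.
move=> fL d0 fg; have [linL [k bL]] := is_diff_linear fL.
apply: (is_diff_bound linL bL) => e e0.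
have [d' d'0 H] := is_diff_eps fL e0.
exists (Num.min d d'); first by rewrite lt_min d0.
move=> h; rewrite le_min => /andP[h1 h2].
have := fg 0; rewrite normr0 addr0 => /(_ (ltW d0)) <-.
by rewrite -fg// H.
Qed.

Lemma is_diff_sum (V W : normedModType R) (I : Type) (s : seq I)
    (f L : I -> V -> W) x :
  (forall i, is_diff x (f i) (L i)) ->
  is_diff x (fun t => \sum_(i <- s) f i t) (fun v => \sum_(i <- s) L i v).
Proof.
move=> fL; elim: s => [|i s IH].
  by apply: (is_diff_ext (is_diff_cst 0 x)) => t; rewrite big_nil.
by apply: (is_diff_ext (is_diffD (fL i) IH)) => t; rewrite big_cons.
Qed.

End DiffLocal.

(** * Pairings with integrals and with rank-one tensors *)

Section IntegralPairing.
Context {R : realType}.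

Lemma sintegrable_inner_cst m n a b (M : R -> 'M[R]_(m, n)) X :
  mx_integrable a b M -> sintegrable a b (fun s => inner (M s) X).
Proof.
move=> iM; apply: (@sintegrable_eq _ _ _ (fun s => \sum_i \sum_j X i j * M s i j)).
  by move=> s _; rewrite innerC.
by apply: sintegrable_sum => i _; apply: sintegrable_sum => j _; exact: sintegrableZ.
Qed.

Lemma inner_mx_integral m n a b (M : R -> 'M[R]_(m, n)) X : mx_integrable a b M ->
  inner (mx_integral a b M) X = sint a b (fun s => inner (M s) X).
Proof.
move=> iM; rewrite innerC /inner.
rewrite (@sint_eq _ a b _ (fun s => \sum_i \sum_j X i j * M s i j)); last first.
  by move=> s _; rewrite -[LHS]/(inner _ _) innerC.
rewrite sint_sum; last first.
  by move=> i _; apply: sintegrable_sum => j _; exact: sintegrableZ.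
apply: eq_bigr => i _; rewrite sint_sum; last by move=> j _; exact: sintegrableZ.
by apply: eq_bigr => j _; rewrite sintZ// mx_integralE.
Qed.

Lemma slice_of_slices r (M : 'I_r -> 'M[R]_r) k : slice (of_slices M) k = M k.
Proof. by rewrite /slice /of_slices rowK mxvecK. Qed.

Lemma inner_slices r (S T : tensor R r) :
  inner S T = \sum_k inner (slice S k) (slice T k).
Proof.
apply: eq_bigr => k _; rewrite /inner pair_bigA/=.
rewrite (reindex (uncurry (@mxvec_index r r)))/=; last exact: curry_mxvec_bij.
by apply: eq_bigr => -[i j] _ /=; rewrite /slice !mxE.
Qed.

Lemma tentry_outer r (x y z : 'cV[R]_r) i j k :
  tentry (outer x y z) i j k = x i 0 * y j 0 * z k 0.
Proof. by rewrite /tentry /outer slice_of_slices mxE. Qed.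

(** Rewrites the term [lam^T (dH : z z^T)] of the adjoint expansion as a pairing with [dH], from
    which the gradient in [H] is read off. *)
Lemma inner_outer r (x y z : 'cV[R]_r) (T : tensor R r) :
  inner (outer x y z) T = inner x (contract2 T y z).
Proof.
rewrite inner_slices inner_colE.
under [RHS]eq_bigr do rewrite mxE mulr_sumr.
under [RHS]eq_bigr do under eq_bigr do rewrite mulr_sumr.
under [RHS]eq_bigr do rewrite exchange_big/=.
rewrite exchange_big/=; apply: eq_bigr => i _; apply: eq_bigr => k _.
apply: eq_bigr => j _; rewrite -/(tentry (outer x y z) i j k) -/(tentry T i j k).
by rewrite tentry_outer; ring.
Qed.

Lemma mx_cont_outer r (x y z : R -> 'cV[R]_r) :
  mx_cont x -> mx_cont y -> mx_cont z -> mx_cont (fun s => outer (x s) (y s) (z s)).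
Proof.
move=> cx cy cz k l; case/mxvec_indexP: l => i j.
have -> : (fun s => outer (x s) (y s) (z s) k (mxvec_index i j)) =
    (fun s => x s i 0 * y s j 0 * z s k 0).
  by apply/funext => s; rewrite -tentryE tentry_outer.
exact: (continuous_fM _ _ (continuous_fM _ _ (cx i 0) (cy j 0)) (cz k 0)).
Qed.

End IntegralPairing.

(** * The differential of one sample cost, then of the Lagrangian in the variables [A] and [H] *)

Section SampleCost.
Context {R : realType} {n m p r : nat}.
Variable D : rom_data R n m p.
Hypothesis D_ok : rom_data_ok D.
Variables (Phi Psi : 'M[R]_(n, r)) (A : 'M[R]_r) (H : tensor R r) (B : 'M[R]_(r, m)).
Hypothesis unit_PsiPhi : Psi^T *m Phi \in unitmx.
Variable z : R -> 'cV[R]_r.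
Hypothesis z_traj : is_trajectory D Psi A H B z.
Notation a := (tstart D).
Notation b := (tend D).
Notation u := (input D).
Let M := invmx (Psi^T *m Phi).
Let zc := z \o clamp a b.

Let ab : a <= b. Proof. exact: tstart_le_tend. Qed.
Let iu : mx_integrable a b u. Proof. exact: input_integrable. Qed.
Let zsol : solves a b u (Psi^T *m state0 D) A H B zc.
Proof. exact: is_trajectory_solves. Qed.

Lemma solves_perturb_params : exists C delta, [/\ 0 <= C, 0 < delta &
  forall d (dPsi : 'M[R]_(n, r)) dA dH dB, d <= delta ->
    `|dPsi| <= d -> `|dA| <= d -> `|dH| <= d -> `|dB| <= d ->
    exists2 z', solves a b u ((Psi + dPsi)^T *m state0 D) (A + dA) (H + dH) (B + dB) z' &
      forall t, a <= t <= b -> `|z' t - zc t| <= C * d].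
Proof.
have [C [delta [C0 delta0 hpert]]] := solves_perturb ab iu zsol.
(* A change of [Psi] of size [d] moves the initial state by at most [n |x0| d]; the 1 makes
   [kap * d] dominate the other perturbations as well. *)
pose kap : R := 1 + n%:R * `|state0 D|.
have kap1 : 1 <= kap by rewrite /kap lerDl mulr_ge0.
have kap0 : 0 < kap by lra.
exists (C * kap), (delta / kap); split.
- by rewrite mulr_ge0// ltW.
- by rewrite divr_gt0.
move=> d dPsi dA dH dB hd nPsi nA nH nB.
have d0 : 0 <= d by exact: le_trans nPsi.
have dk : d <= kap * d by rewrite ler_peMl.
have kd : kap * d <= delta by rewrite mulrC -ler_pdivlMr.
have nz0 : `|dPsi^T *m state0 D| <= kap * d.
  apply: le_trans (mulmx_norm_le _ _) _.
  apply: (@le_trans _ _ (n%:R * d * `|state0 D|)).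
    by rewrite ler_wpM2r// ler_wpM2l// (le_trans (trmx_norm_le _)).
  rewrite /kap; lra.
have [z' z'sol hz'] := hpert (kap * d) _ dA dH dB kd nz0 (le_trans nA dk)
  (le_trans nH dk) (le_trans nB dk).
exists z'; first by rewrite linearD/= mulmxDl.
by move=> t tab; rewrite -mulrA; exact: hz'.
Qed.

(** Brings the adjoint equation into the increment form used by integration by parts; both [z] and
    the adjoint are clamped so that the right-hand side is continuous on the whole line. *)
Lemma adjoint_integral_eq i lam : (i < nsamp D)%N ->
  is_adjoint D Phi Psi A H B z i lam ->
  let lamc := lam \o clamp a (time D i) in
  mx_cont lamc /\ forall s t, a <= s -> s <= t -> t <= time D i ->
    lamc t - lamc s = mx_integral s t (fun s' =>
      - ((Jac (fun z' => red_field A H B z' (u s')) (zc s'))^T *m lamc s')).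
Proof.
move=> iN [clam dlam _] lamc.
have /andP[at_ tb] := time_itv D_ok iN.
have cl : mx_cont lamc.
  by apply: continuous_mx_cont; exact: within_continuous_clamp at_ clam.
split => // s t as_ st tt.
have [cz _] := zsol.
have cJl := mx_contM (mx_cont_tr (mx_cont_Jac_red_field A H B u _ cz)) cl.
apply/colP => k; rewrite mxE [X in _ + X]mxE mx_integralE.
pose f s' := (- ((Jac (fun z' => red_field A H B z' (u s')) (zc s'))^T *m lamc s')) k (0 : 'I_1).
have cf : continuous f.
  have -> : f = (fun s' => 0 -
      ((Jac (fun z' => red_field A H B z' (u s')) (zc s'))^T *m lamc s') k 0).
    by apply/funext => s'; rewrite /f mxE sub0r.
  exact: (continuous_fB (fun=> 0) _ (continuous_fcst 0) (cJl k 0)).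
rewrite /lamc/= !clamp_id ?as_ ?(le_trans as_)//= ?(le_trans st)//.
apply: (@sint_derivable _ a (time D i) f (fun s => lam s k 0)) => //.
  apply: clamp_within_continuous; exact: (cl k 0).
move=> s' s'i; have [dl1 dl2] := dlam s' s'i.
move: s'i; rewrite in_itv/= => /andP[as' s't].
have dk : derivable (fun s => lam s k 0) s' 1.
  by move/derivable_mxP: dl1; apply.
split => //; rewrite /f /zc /lamc/= !clamp_id ?ltW// ?(lt_le_trans s't)//.
rewrite -dl2 opprK derive1E derive1E derive_mx// mxE//.
Qed.

(** The output cost is expanded at the increment [(dPhi, dPsi, w)]. The adjoint expansion then
    trades the pairing of its terminal value with [w] for terms linear in the parameters, up to
    [k d^2], so [w] disappears from the differential. *)
Lemma is_diff_sample_cost i lam : (i < nsamp D)%N ->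
  is_adjoint D Phi Psi A H B z i lam ->
  is_diff (Phi, Psi, A, H, B)
    (fun q : 'M[R]_(n, r) * 'M[R]_(n, r) * 'M[R]_r * tensor R r * 'M[R]_(r, m) =>
      enorm (out_err D q.1.1.1.1 q.1.1.1.2
        (trajectory D q.1.1.1.2 q.1.1.2 q.1.2 q.2) i) ^+ 2 : R^o)
    (fun v => inner (- (2 *: ((1%:M - Psi *m M^T *m Phi^T) *m (out_jac D Phi Psi z i)^T
                 *m out_err D Phi Psi z i *m (z (time D i))^T *m M^T))) v.1.1.1.1
       + inner (2 *: (Phi *m M *m z (time D i) *m (out_err D Phi Psi z i)^T
                 *m out_jac D Phi Psi z i *m Phi *m M) - state0 D *m (lam a)^T) v.1.1.1.2
       + inner (- mx_integral a (time D i) (fun s => lam s *m (z s)^T)) v.1.1.2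
       + inner (- mx_integral a (time D i) (fun s => outer (lam s) (z s) (z s))) v.1.2
       + inner (- mx_integral a (time D i) (fun s => lam s *m (u s)^T)) v.2).
Proof.
move=> iN lam_adj.
have tab := time_itv D_ok iN; have /andP[at_ tb] := tab.
have [cl lam_eq] := adjoint_integral_eq iN lam_adj.
set lamc := lam \o _ in cl lam_eq.
have [_ _ lamT] := lam_adj.
have [cz _] := zsol.
have [_ _ _ dh] := D_ok.
have zct : zc (time D i) = z (time D i) by rewrite /zc/= clamp_id.
set e := out_err D Phi Psi z i in lamT *.
set C := out_jac D Phi Psi z i in lamT *.
have [Cw [dlt0 [Cw0 dlt00 hpert]]] := solves_perturb_params.
have [k k0 hexp] := adjoint_expansion ab iu tab zsol cl lam_eq Cw0.
pose F (q : 'M[R]_(n, r) * 'M[R]_(n, r) * 'cV[R]_r) : R^o :=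
  enorm (output D i - outmap D (lift_state q.1.1 q.1.2 q.2)) ^+ 2.
have dF := is_diff_out_cost (output D i) unit_PsiPhi (dh (lift_state Phi Psi (z (time D i)))).
cbv zeta in dF.
rewrite -/M -/(out_jac D Phi Psi z i) -/(out_err D Phi Psi z i) -/e -/C in dF.
set G1 := - (2 *: _) in dF *; set G2 := 2 *: (Phi *m M *m _ *m _ *m _ *m _ *m _) in dF *.
have lamE : 2 *: (M^T *m Phi^T *m C^T *m e) = lamc (time D i).
  by rewrite /lamc/= clamp_id ?at_ ?lexx// lamT /M trmx_inv trmx_mul trmxK.
rewrite lamE in dF.
set GA := - mx_integral _ _ (fun s => lam s *m (z s)^T).
set GH := - mx_integral _ _ (fun s => outer (lam s) (z s) (z s)).
set GB := - mx_integral _ _ (fun s => lam s *m (u s)^T).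
have lamca : lamc a = lam a by rewrite /lamc/= clamp_id// lexx.
have inG (dA : 'M[R]_r) (dH : tensor R r) (dB : 'M[R]_(r, m)) :
    inner GA dA + inner GH dH + inner GB dB =
    - sint a (time D i) (fun s => inner (lamc s)
           (dA *m zc s + contract2 dH (zc s) (zc s) + dB *m u s)).
  have eA : GA = - mx_integral a (time D i) (fun s => lamc s *m (zc s)^T).
    congr (- _); apply: mx_integral_eq => s /andP[as_ st].
    by rewrite /lamc /zc/= !clamp_id ?as_ ?(le_trans st).
  have eH : GH = - mx_integral a (time D i) (fun s => outer (lamc s) (zc s) (zc s)).
    congr (- _); apply: mx_integral_eq => s /andP[as_ st].
    by rewrite /lamc /zc/= !clamp_id ?as_ ?(le_trans st).
  have eB : GB = - mx_integral a (time D i) (fun s => lamc s *m (u s)^T).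
    congr (- _); apply: mx_integral_eq => s /andP[as_ st].
    by rewrite /lamc /= clamp_id ?as_ ?(le_trans st).
  have iA : mx_integrable a (time D i) (fun s => lamc s *m (zc s)^T).
    by apply: mx_cont_integrable; exact: mx_contM cl (mx_cont_tr cz).
  have iH : mx_integrable a (time D i) (fun s => outer (lamc s) (zc s) (zc s)).
    by apply: mx_cont_integrable; exact: mx_cont_outer.
  have iB : mx_integrable a (time D i) (fun s => lamc s *m (u s)^T).
    apply: mx_integrableM => //; apply: mx_integrable_tr.
    exact: mx_integrableS iu.
  rewrite eA eH eB !innerNl !inner_mx_integral// -!opprD -!sintD; first last.
  - exact: sintegrable_inner_cst.
  - exact: sintegrable_inner_cst.
  - exact: sintegrable_inner_cst.
  - by apply: sintegrableD; exact: sintegrable_inner_cst.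
  congr (- _); apply: sint_eq => s _.
  by rewrite !innerDr inner_outer [in RHS]inner_mulmxr [X in _ = _ + _ + X]inner_mulmxr.
pose x0 := state0 D.
(* The shift of the initial state is the source of the term [- x0 lam(t0)^T] in the gradient for
   [Psi]. *)
have inP (dPsi : 'M[R]_(n, r)) :
    inner (x0 *m (lam a)^T) dPsi = inner (lamc a) (dPsi^T *m x0).
  by rewrite inner_mulmxr -[LHS]inner_tr trmx_mul trmxK lamca.
(* Bounds the increment [(dPhi, dPsi, w)] by [c'] times the size of the perturbation. *)
pose c' := 1 + Cw.
have c'0 : 0 < c' by rewrite /c' ltr_pwDl.
apply: (@is_diff_bound _ _ _ _ _ _ (n%:R * r%:R * `|G1| +
    n%:R * r%:R * `|G2 - x0 *m (lam a)^T| + r%:R * r%:R * `|GA| +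
    r%:R * (r * r)%:R * `|GH| + r%:R * m%:R * `|GB|)).
- by move=> s v v'; rewrite /= !innerDr !innerZr /GRing.scale/=; ring.
- move=> v.
  have n1 := fst_norm_le v; have n2 := fst_norm_le v.1.
  have n3 := fst_norm_le v.1.1; have n4 := fst_norm_le v.1.1.1.
  have s1 := snd_norm_le v; have s2 := snd_norm_le v.1.
  have s3 := snd_norm_le v.1.1; have s4 := snd_norm_le v.1.1.1.
  have key n1' n2' (X Y : 'M[R]_(n1', n2')) : `|Y| <= `|v| ->
      `|inner X Y| <= n1'%:R * n2'%:R * `|X| * `|v|.
    move=> h; apply: le_trans (inner_norm_le _ _) _.
    by rewrite ler_wpM2l// !mulr_ge0.
  have m1 := le_trans s2 n1; have m2 := le_trans s3 (le_trans n2 n1).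
  have m3 := le_trans s4 (le_trans n3 (le_trans n2 n1)).
  have m4 := le_trans n4 (le_trans n3 (le_trans n2 n1)).
  do 4! [apply: le_trans (ler_normD _ _) _; rewrite mulrDl;
         apply: lerD; last exact: key].
  exact: key.
move=> eps eps0.
have e1 : 0 < eps / (2 * c') by rewrite divr_gt0// mulr_gt0.
have [d1 d10 hF] := is_diff_eps dF e1.
(* In order: existence of the perturbed trajectory; [d <= 1] for the adjoint expansion; the radius
   [d1] of the output expansion, shrunk by [c']; and [k d^2 <= (eps / 2) d]. The other half of [eps]
   is spent in [e1]. *)
exists (Num.min (Num.min dlt0 1) (Num.min (d1 / c') (eps / (2 * (k + 1))))).
  rewrite !lt_min dlt00 ltr01 !divr_gt0//; rewrite mulr_gt0//; lra.
move=> v; rewrite !le_min => /andP[/andP[v1 v2] /andP[v3 v4]].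
have n1 := fst_norm_le v; have n2 := fst_norm_le v.1.
have n3 := fst_norm_le v.1.1; have n4 := fst_norm_le v.1.1.1.
have s1 := snd_norm_le v; have s2 := snd_norm_le v.1.
have s3 := snd_norm_le v.1.1; have s4 := snd_norm_le v.1.1.1.
have nPhi := le_trans n4 (le_trans n3 (le_trans n2 n1)).
have nPsi := le_trans s4 (le_trans n3 (le_trans n2 n1)).
have nA := le_trans s3 (le_trans n2 n1).
have nH := le_trans s2 n1.
move=> {n1 n2 n3 n4 s2 s3 s4}.
have v0 : 0 <= `|v| by [].
move: (`|v|) v1 v2 v3 v4 nPhi nPsi nA nH s1 v0 => nv.
case: v => -[[[dPhi dPsi] dA] dH] dB v1 v2 v3 v4 /= nPhi nPsi nA nH s1 v0.
have [z' z'sol hz'] := hpert nv dPsi dA dH dB v1 nPsi nA nH s1.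
have z'sol' := z'sol; rewrite linearD/= mulmxDl in z'sol'.
have hk := hexp nv _ _ _ _ _ v2 nA nH s1 z'sol' hz'.
rewrite /= /out_err (trajectoryE D_ok z'sol tab) (trajectoryE D_ok zsol tab) zct.
pose w := z' (time D i) - z (time D i).
have z'E : z' (time D i) = z (time D i) + w by rewrite /w addrC subrK.
have nw : `|w| <= Cw * nv by have := hz' _ tab; rewrite zct.
pose q : 'M[R]_(n, r) * 'M[R]_(n, r) * 'cV[R]_r := (dPhi, dPsi, w).
have nq : `|q| <= c' * nv.
  apply: pair_norm_le; rewrite /= /c' mulrDl mul1r.
    apply: le_trans (_ : nv <= _); last by rewrite lerDl mulr_ge0.
    exact: pair_norm_le.
  by apply: le_trans nw _; rewrite lerDr.
have := hF q; rewrite /q/= => /(_ _)/=.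
have qd1 : `|q| <= d1 by apply: le_trans nq _; rewrite mulrC -ler_pdivlMr.
move=> /(_ qd1).
rewrite zct -/w in hk.
rewrite z'E.
set F1 := enorm (output D i - outmap D (lift_state (Phi + dPhi) _ _)) ^+ 2.
set F0 := enorm (output D i - outmap D (lift_state Phi _ _)) ^+ 2.
move=> h1.
have h2 : eps / (2 * c') * `|q| <= eps / 2 * nv.
  apply: (@le_trans _ _ (eps / (2 * c') * (c' * nv))).
    by rewrite ler_wpM2l// ltW.
  by rewrite le_eqVlt; apply/orP; left; apply/eqP; field; lra.
have h3 : k * nv ^+ 2 <= eps / 2 * nv.
  rewrite expr2 mulrA ler_wpM2r//; apply: (@le_trans _ _ (k * (eps / (2 * (k + 1))))).
    by rewrite ler_wpM2l.
  rewrite mulrA ler_pdivrMr; last lra.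
  rewrite [leRHS](_ : _ = k * eps + eps); last by field.
  lra.
have inGv := inG dA dH dB.
have inPv := inP dPsi.
rewrite (innerDl G2) (innerNl (state0 D *m _)) inPv.
have {}h1 := le_trans h1 h2.
move: h1 hk; rewrite -/x0 !ler_norml => /andP[h1 h1'] /andP[hk hk'].
apply/andP; split; lra.
Qed.

Lemma is_diff_lagrangian_AH (lam : nat -> R -> 'cV[R]_r) :
  (forall i, (i < nsamp D)%N -> is_adjoint D Phi Psi A H B z i (lam i)) ->
  let M' := invmx (Phi^T *m Psi) in
  let C := out_jac D Phi Psi z in
  let e := out_err D Phi Psi z in
  let N := nsamp D in
  let t := time D in
  is_diff (Phi, Psi, A, H, B)
    (fun q : 'M[R]_(n, r) * 'M[R]_(n, r) * 'M[R]_r * tensor R r * 'M[R]_(r, m) =>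
      lagrangian_AH D lam q.1.1.1.1 q.1.1.1.2 q.1.1.2 q.1.2 q.2 : R^o)
    (fun v => inner (- (2 *: \sum_(i < N) (1%:M - Psi *m M' *m Phi^T) *m (C i)^T
                 *m e i *m (z (t i))^T *m M')) v.1.1.1.1
       + inner (\sum_(i < N) (2 *: (Phi *m M *m z (t i) *m (e i)^T
                 *m C i *m Phi *m M) - state0 D *m (lam i a)^T)) v.1.1.1.2
       + inner (- \sum_(i < N) mx_integral a (t i) (fun s => lam i s *m (z s)^T)) v.1.1.2
       + inner (- \sum_(i < N) mx_integral a (t i) (fun s => outer (lam i s) (z s) (z s))) v.1.2
       + inner (- \sum_(i < N) mx_integral a (t i) (fun s => lam i s *m (u s)^T)) v.2).
Proof.
move=> lam_adj M' C e N t.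
have MT : M^T = M' by rewrite /M trmx_inv trmx_mul trmxK.
have dS := is_diff_sum (index_enum 'I_N)
  (fun i => is_diff_sample_cost (ltn_ord i) (lam_adj _ (ltn_ord i))).
have [Cw [delta [_ delta0 hpert]]] := solves_perturb_params.
(* Within [delta] the perturbed trajectory exists and the Lagrangian reduces to the squared
   errors. *)
apply: (is_diff_local _ delta0).
  apply: (is_diff_ext dS) => [q|v]; first by [].
  by rewrite MT 4!big_split/= -!inner_suml scaler_sumr -!sumrN.
move=> v hv.
have n1 := fst_norm_le v; have n2 := fst_norm_le v.1.
have n3 := fst_norm_le v.1.1; have s1 := snd_norm_le v.
have nPsi := le_trans (snd_norm_le v.1.1.1) (le_trans n3 (le_trans n2 n1)).
have nA := le_trans (snd_norm_le v.1.1) (le_trans n2 n1).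
have nH := le_trans (snd_norm_le v.1) n1.
have [z' z'sol _] := hpert _ _ _ _ _ hv nPsi nA nH s1.
rewrite /= (lagrangian_AHE D_ok lam _ z'sol); apply: eq_bigr => i _.
by rewrite /out_err (trajectoryE D_ok z'sol (time_itv D_ok (ltn_ord i))).
Qed.

End SampleCost.

(** * The parametrization of the reduced-order model *)

Section Parametrization.
Context {R : realType} {r : nat}.
Implicit Types (V : normedModType R).

Lemma is_diff_A_of V (fK fR fQ dK dR dQ : V -> 'M[R]_r) x :
  is_diff x fK dK -> is_diff x fR dR -> is_diff x fQ dQ ->
  is_diff x (fun t => A_of (fK t) (fR t) (fQ t))
    (fun h => (dK h - (dK h)^T - (dR h *m (fR x)^T + fR x *m (dR h)^T)) *m fQ x
       + (fK x - (fK x)^T - fR x *m (fR x)^T) *m dQ h).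
Proof.
move=> hK hR hQ; apply: is_diff_mulmx => //.
exact: (is_diffB (is_diffB hK (is_diff_trmx hK)) (is_diff_mulmx hR (is_diff_trmx hR))).
Qed.

Lemma slice_linear k : linear (fun S : tensor R r => slice S k).
Proof. by move=> a S T; rewrite /slice !linearP. Qed.

Lemma of_slices_linear a (M N : 'I_r -> 'M[R]_r) :
  of_slices (fun k => a *: M k + N k) = a *: of_slices M + of_slices N.
Proof. by apply/row_matrixP => k; rewrite linearP/= !rowK linearP. Qed.

Lemma H_of_entry (S : tensor R r) Q k i j :
  H_of S Q k (mxvec_index i j) = ((slice S k - (slice S k)^T) *m Q) i j.
Proof. by rewrite mxE mxvecE. Qed.

Lemma H_of_norm_le (S : tensor R r) Q : `|H_of S Q| <= r%:R * 2 * `|S| * `|Q|.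
Proof.
apply: mx_norm_le => [|k l]; first by rewrite !mulr_ge0.
case/mxvec_indexP: l => i j; rewrite H_of_entry.
apply: le_trans (mx_entry_le _ _ _) _; apply: le_trans (mulmx_norm_le _ _) _.
rewrite ler_wpM2r// -mulrA ler_wpM2l//.
have hs : `|slice S k| <= `|S|.
  by apply: mx_norm_le => // i' j'; rewrite /slice !mxE mx_entry_le.
apply: le_trans (ler_normB _ _) _; have := trmx_norm_le (slice S k); lra.
Qed.

Lemma is_diff_H_of V (fS dS : V -> tensor R r) (fQ dQ : V -> 'M[R]_r) x :
  is_diff x fS dS -> is_diff x fQ dQ ->
  is_diff x (fun t => H_of (fS t) (fQ t)) (fun h => H_of (dS h) (fQ x) + H_of (fS x) (dQ h)).
Proof.
apply: (@is_diff_bilinear_bound _ _ _ _ _ (@H_of R r) (r%:R * 2)).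
- move=> Q a S T; rewrite /H_of -of_slices_linear; congr of_slices.
  apply/funext => k; rewrite slice_linear linearP/= scalemxAl -mulmxDl.
  by rewrite scalerBr opprD addrACA.
- move=> S a P Q; rewrite /H_of -of_slices_linear; congr of_slices.
  by apply/funext => k; rewrite mulmxDr scalemxAr.
- exact: H_of_norm_le.
Qed.

Lemma H_of0 (Q : 'M[R]_r) : H_of 0 Q = 0.
Proof.
by apply/eqP; rewrite -normr_le0; apply: le_trans (H_of_norm_le _ _) _;
  rewrite normr0 mulr0 mul0r.
Qed.

Lemma is_diff_Qtilde (Q : 'M[R]_r) : Q \in unitmx ->
  is_diff Q (@Qtilde R r) (fun h => - (invmx Q *m h *m invmx Q) *m (invmx Q)^T
     + invmx Q *m (- (invmx Q *m h *m invmx Q))^T).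
Proof.
move=> uQ; have dI := is_diff_invmx uQ.
exact: (is_diff_mulmx dI (is_diff_trmx dI)).
Qed.

Lemma Qtilde_sym (Q : 'M[R]_r) : (Qtilde Q)^T = Qtilde Q.
Proof. by rewrite /Qtilde trmx_mul trmxK. Qed.

(** Computes the adjoint of the linear map from [(dK, dR)] to the variation of [A]. Transposes on
    [dK] and [dR] are moved to the other factor, where symmetry of [Qt] turns [(G Qt)^T] into
    [Qt G^T]. *)
Lemma inner_A_of_KR (G K Rd Qt dK dR : 'M[R]_r) : Qt^T = Qt ->
  inner G ((dK - dK^T - (dR *m Rd^T + Rd *m dR^T)) *m Qt) =
  inner (G *m Qt - Qt *m G^T) dK + inner (- (G *m Qt + Qt *m G^T) *m Rd) dR.
Proof.
move=> sQ; rewrite inner_mulmxr sQ !innerDr !innerNr.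
have t1 : inner (G *m Qt) dK^T = inner (Qt *m G^T) dK.
  by rewrite -inner_tr trmxK trmx_mul sQ.
have t2 : inner (G *m Qt) (dR *m Rd^T) = inner (G *m Qt *m Rd) dR.
  by rewrite inner_mulmxr trmxK.
have t3 : inner (G *m Qt) (Rd *m dR^T) = inner (Qt *m G^T *m Rd) dR.
  by rewrite inner_mulmxl -inner_tr trmxK !trmx_mul trmxK sQ.
rewrite innerDr t1 t2 t3 mulNmx mulmxDl !innerDl !innerNl innerDl; ring.
Qed.

Lemma inner_H_of_S (G dS : tensor R r) (Qt : 'M[R]_r) : Qt^T = Qt ->
  inner G (H_of dS Qt) =
  inner (of_slices (fun k => slice G k *m Qt - Qt *m (slice G k)^T)) dS.
Proof.
move=> sQ; rewrite !inner_slices; apply: eq_bigr => k _.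
rewrite !slice_of_slices inner_mulmxr sQ innerDr innerNr innerDl innerNl.
by congr (_ - _); rewrite -inner_tr trmxK trmx_mul sQ.
Qed.

Lemma inner_A_H_of_Qt (K Rd GA dQ : 'M[R]_r) (S GH : tensor R r) :
  inner GA ((K - K^T - Rd *m Rd^T) *m dQ) + inner GH (H_of S dQ) =
  inner ((K - K^T - Rd *m Rd^T)^T *m GA
    + \sum_(k < r) ((slice S k)^T - slice S k) *m slice GH k) dQ.
Proof.
rewrite innerDl -inner_mulmxl; congr (_ + _).
rewrite inner_suml inner_slices; apply: eq_bigr => k _.
rewrite slice_of_slices inner_mulmxl; congr inner; congr (_ *m _).
by rewrite linearB/= trmxK.
Qed.

(** The two summands are transposes of each other, so pairing their sum with [G] is pairing the
    first one with [G + G^T]. *)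
Lemma inner_dQtilde (G Q dQ : 'M[R]_r) :
  inner G (- (invmx Q *m dQ *m invmx Q) *m (invmx Q)^T
     + invmx Q *m (- (invmx Q *m dQ *m invmx Q))^T) =
  inner (- ((invmx Q)^T *m (G + G^T) *m (Qtilde Q))) dQ.
Proof.
set Y := invmx Q.
rewrite innerDr mulNmx linearN/= mulmxN !innerNr innerNl -opprD; congr (- _).
rewrite mulmxDr mulmxDl innerDl; congr (_ + _).
  by rewrite -(mulmxA (Y *m dQ)) inner_sandwich trmx_mul trmxK.
rewrite !trmx_mul !mulmxA inner_sandwich -inner_tr trmxK !trmx_mul !trmxK.
by rewrite /Qtilde -/Y !mulmxA.
Qed.

End Parametrization.

(** * From differentials to Riemannian gradients *)

Section Gradients.
Context {R : realType}.

Lemma is_diff_const (V W : normedModType R) (c : W) (x : V) :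
  is_diff x (fun=> c) (fun=> 0).
Proof. exact: is_diff_cst. Qed.

Lemma is_diff_is_gradient (V : normedModType R) (g : V -> V -> R) (f : V -> R)
    (L : V -> R) x G :
  is_diff x (f : V -> R^o) (L : V -> R^o) -> (forall v, L v = g G v) ->
  is_gradient g f x G.
Proof.
move=> fL Lg; split; first by case: fL.
by move=> v; rewrite -Lg; have <- := @diff_val _ _ _ _ _ _ _ fL.
Qed.

(** If [v Phi^T Phi = 0] then [v Phi^T] has zero norm, so [v Phi^T Psi = 0] and [v = 0]. *)
Lemma gram_unitmx n r (Phi Psi : 'M[R]_(n, r)) : Psi^T *m Phi \in unitmx ->
  Phi^T *m Phi \in unitmx.
Proof.
move=> u; rewrite -row_free_unit -kermx_eq0; apply: contraT.
move=> /rowV0Pn[v /sub_kermxP vk v0].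
have vPhi : v *m Phi^T = 0.
  have h : inner (v *m Phi^T) (v *m Phi^T) = 0.
    by rewrite inner_mulmxr trmxK -mulmxA vk inner0l.
  apply/matrixP => i j; rewrite [RHS]mxE; apply/eqP; rewrite -sqrf_eq0.
  have /eqP := h; rewrite psumr_eq0 => [/allP/(_ i)|i' _]; last first.
    by apply: sumr_ge0 => j' _; rewrite -expr2 sqr_ge0.
  rewrite mem_index_enum => /(_ isT)/=; rewrite psumr_eq0 => [/allP/(_ j)|j' _].
    by rewrite mem_index_enum => /(_ isT); rewrite expr2.
  by rewrite -expr2 sqr_ge0.
have uT : Phi^T *m Psi \in unitmx by rewrite -unitmx_tr trmx_mul trmxK.
have : v = 0.
  by apply: (can_inj (mulmxK uT)); rewrite mulmxA vPhi !mul0mx.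
by move/eqP; rewrite (negPf v0).
Qed.

(** Multiplying the Euclidean gradient by the Gram matrix cancels the inverse Gram matrix in the
    metric of the [Phi] factor. *)
Lemma trace_gram n r (Phi X Y : 'M[R]_(n, r)) : Phi^T *m Phi \in unitmx ->
  \tr (invmx (Phi^T *m Phi) *m (X *m (Phi^T *m Phi))^T *m Y) = inner X Y.
Proof.
by move=> u; rewrite trmx_mul trmx_mul trmxK mulKmx// inner_trace.
Qed.

End Gradients.

Theorem proposition2p3 (R : realType) (n r m p : nat)
  (n_gt0 : (0 < n)%N) (r_gt0 : (0 < r)%N) (m_gt0 : (0 < m)%N) (p_gt0 : (0 < p)%N)
  (le_r_n : (r <= n)%N)
  (D : rom_data R n m p) (D_ok : rom_data_ok D)
  (Phi Psi : 'M[R]_(n, r)) (K Rd Q : 'M[R]_r) (S : tensor R r) (B : 'M[R]_(r, m))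
  (rank_Phi : \rank Phi = r)
  (unit_PsiPhi : Psi^T *m Phi \in unitmx) (unit_Q : Q \in unitmx)
  (z : R -> 'cV[R]_r)
  (z_traj : is_trajectory D Psi (A_of K Rd (Qtilde Q)) (H_of S (Qtilde Q)) B z)
  (lam : nat -> R -> 'cV[R]_r)
  (lam_adj : forall i, (i < nsamp D)%N ->
     is_adjoint D Phi Psi (A_of K Rd (Qtilde Q)) (H_of S (Qtilde Q)) B z i (lam i)) :
  let Qt := invmx Q *m (invmx Q)^T in
  let N := nsamp D in
  let t0 := tstart D in
  let t := time D in
  let u := input D in
  let x0 := state0 D in
  let e := out_err D Phi Psi z in
  let C := out_jac D Phi Psi z in
  let gA : 'M[R]_r :=
    - \sum_(i < N) mx_integral t0 (t i) (fun s => lam i s *m (z s)^T) in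
  let gH : tensor R r :=
    - \sum_(i < N) mx_integral t0 (t i) (fun s => outer (lam i s) (z s) (z s)) in
  let gQt : 'M[R]_r :=
    (K - K^T - Rd *m Rd^T)^T *m gA
    + \sum_(k < r) ((slice S k)^T - slice S k) *m slice gH k in
  let gPhi : 'M[R]_(n, r) :=
    - (2 *: \sum_(i < N)
        (1%:M - Psi *m invmx (Phi^T *m Psi) *m Phi^T) *m (C i)^T *m e i
          *m (z (t i))^T *m invmx (Phi^T *m Psi)) *m (Phi^T *m Phi) in
  let gPsi : 'M[R]_(n, r) :=
    \sum_(i < N)
      (2 *: (Phi *m invmx (Psi^T *m Phi) *m z (t i) *m (e i)^T *m C i *m Phi
               *m invmx (Psi^T *m Phi))
       - x0 *m (lam i t0)^T) in
  let gK : 'M[R]_r := gA *m Qt - Qt *m gA^T in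
  let gR : 'M[R]_r := - (gA *m Qt + Qt *m gA^T) *m Rd in
  let gQ : 'M[R]_r := - ((invmx Q)^T *m (gQt + gQt^T) *m Qt) in
  let gS : tensor R r :=
    of_slices (fun k => slice gH k *m Qt - Qt *m (slice gH k)^T) in
  let gB : 'M[R]_(r, m) :=
    - \sum_(i < N) mx_integral t0 (t i) (fun s => lam i s *m (u s)^T) in
  [/\ is_gradient (@inner R r r)
        (fun A => lagrangian_AH D lam Phi Psi A (H_of S Qt) B) (A_of K Rd Qt) gA,
      is_gradient (@inner R r (r * r))
        (fun H => lagrangian_AH D lam Phi Psi (A_of K Rd Qt) H B) (H_of S Qt) gH,
      is_gradient (@inner R r r)
        (fun Qt' => lagrangian_Qt D lam Phi Psi K Rd Qt' S B) Qt gQt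
    & is_gradient (metric (Phi, Psi, K, Rd, Q, S, B))
        (lagrangian D lam) (Phi, Psi, K, Rd, Q, S, B)
        (gPhi, gPsi, gK, gR, gQ, gS, gB)].
Proof.
move=> Qt N t0 t u x0 e C gA gH gQt gPhi gPsi gK gR gQ gS gB.
have master := is_diff_lagrangian_AH D_ok unit_PsiPhi z_traj lam_adj.
cbv zeta in master.
rewrite -/t0 -/N -/t -/C -/e -/u -/x0 -/gA -/gH -/gB -/gPsi in master.
(* The Euclidean gradient in [Phi]; the factor [Phi^T Phi] is brought in by the metric. *)
set gPhiE := - (2 *: \sum_(i < _) _) in master.
have QtE : Qtilde Q = Qt by [].
have sQt : Qt^T = Qt by exact: Qtilde_sym.
rewrite QtE in z_traj lam_adj master.
split.
(* Composing with the inclusion of a single slot kills all other components of the differential. *)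
- have hp : is_diff (A_of K Rd Qt) (fun A => (Phi, Psi, A, H_of S Qt, B))
      (fun dA => (0, 0, dA, 0, 0)).
    exact: is_diff_pair (is_diff_pair (is_diff_pair (is_diff_pair
      (is_diff_const _ _) (is_diff_const _ _)) (is_diff_id _)) (is_diff_const _ _))
      (is_diff_const _ _).
  apply: (is_diff_is_gradient (is_diff_comp hp master)) => v /=.
  by rewrite ![inner _ 0]innerC !inner0l !addr0 !add0r.
- have hp : is_diff (H_of S Qt) (fun H => (Phi, Psi, A_of K Rd Qt, H, B))
      (fun dH => (0, 0, 0, dH, 0)).
    exact: is_diff_pair (is_diff_pair (is_diff_pair (is_diff_pair
      (is_diff_const _ _) (is_diff_const _ _)) (is_diff_const _ _)) (is_diff_id _))
      (is_diff_const _ _).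
  apply: (is_diff_is_gradient (is_diff_comp hp master)) => v /=.
  by rewrite ![inner _ 0]innerC !inner0l !addr0 !add0r.
- have dA := is_diff_A_of (is_diff_const K Qt) (is_diff_const Rd Qt) (is_diff_id Qt).
  have dH := is_diff_H_of (is_diff_const S Qt) (is_diff_id Qt).
  have hp := is_diff_pair (is_diff_pair (is_diff_pair (is_diff_pair
    (is_diff_const Phi Qt) (is_diff_const Psi Qt)) dA) dH) (is_diff_const B Qt).
  apply: (is_diff_is_gradient (is_diff_comp hp master)) => v /=.
  rewrite trmx0 mulmx0 mul0mx subr0 addr0 subr0 mul0mx add0r H_of0 add0r.
  rewrite [inner _ 0]innerC [inner gPsi 0]innerC [inner gB 0]innerC !inner0l.
  by rewrite !addr0 !add0r inner_A_H_of_Qt.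
set x : ambient R n m r := (Phi, Psi, K, Rd, Q, S, B).
have p1 := is_diff_fst x; have p2 := is_diff_comp p1 (is_diff_fst x.1).
have p3 := is_diff_comp p2 (is_diff_fst x.1.1).
have p4 := is_diff_comp p3 (is_diff_fst x.1.1.1).
have p5 := is_diff_comp p4 (is_diff_fst x.1.1.1.1).
have dPhi := is_diff_comp p5 (is_diff_fst x.1.1.1.1.1).
have dPsi := is_diff_comp p5 (is_diff_snd x.1.1.1.1.1).
have dK := is_diff_comp p4 (is_diff_snd x.1.1.1.1).
have dR := is_diff_comp p3 (is_diff_snd x.1.1.1).
have dQ := is_diff_comp (is_diff_comp p2 (is_diff_snd x.1.1)) (is_diff_Qtilde unit_Q).
have dS := is_diff_comp p1 (is_diff_snd x.1).
have dB := is_diff_snd x.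
have hp := is_diff_pair (is_diff_pair (is_diff_pair (is_diff_pair dPhi dPsi)
  (is_diff_A_of dK dR dQ)) (is_diff_H_of dS dQ)) dB.
have hL := is_diff_comp hp master.
(* Projections replace the pattern matching on the tuple, the form in which the chain rule delivers
   the composite. *)
have lagE : lagrangian D lam = (fun x : ambient R n m r =>
    lagrangian_AH D lam x.1.1.1.1.1.1 x.1.1.1.1.1.2
      (A_of x.1.1.1.1.2 x.1.1.1.2 (Qtilde x.1.1.2)) (H_of x.1.2 (Qtilde x.1.1.2)) x.2).
  by apply/funext => -[[[[[[? ?] ?] ?] ?] ?] ?].
rewrite lagE.
apply: (is_diff_is_gradient hL) => -[[[[[[vPhi vPsi] vK] vR] vQ] vS] vB] /=.
rewrite QtE (trace_gram _ _ (gram_unitmx unit_PsiPhi)) -inner_trace -/gPhiE.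
rewrite (innerDr gA) (innerDr gH) inner_A_of_KR// inner_H_of_S//.
(* [Q] acts through [Qtilde] on [A] and on [H] at once; the two contributions assemble into
   [gQt]. *)
have -> : inner gQ vQ = inner gA ((K - K^T - Rd *m Rd^T) *m
      (- (invmx Q *m vQ *m invmx Q) *m (invmx Q)^T
       + invmx Q *m (- (invmx Q *m vQ *m invmx Q))^T))
    + inner gH (H_of S (- (invmx Q *m vQ *m invmx Q) *m (invmx Q)^T
       + invmx Q *m (- (invmx Q *m vQ *m invmx Q))^T)).
  by rewrite inner_A_H_of_Qt inner_dQtilde.
by rewrite -/gK -/gR -/gS; ring.
Qed.
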